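(* Let $F$ be a field of characteristic $0$, $d\ge1$, and let $\lambda\vdash k$ be a partition. The tensor polynomial $ST(\lambda)(x_1,\dots,x_k)$ is NOT a tensor polynomial identity of $d\times d$ matrices $M_d(F)$ if and only if $k\le d^2$ and $\lambda\oplus1^{d^2-k}$ is a refinement of the partition $\delta_d:=(2d-1,2d-3,\dots,5,3,1)\vdash d^2$.
   Context: $F\langle X\rangle$ is the free associative algebra in $x_1,x_2,\dots$; elements of $F\langle X\rangle^{\otimes n}$ are tensor polynomials, and such an element is a tensor polynomial identity (TPI) of $M_d(F)$ if it vanishes in $M_d(F)^{\otimes n}$ under every evaluation $x_i\mapsto A_i\in M_d(F)$ (extended to an algebra homomorphism $F\langle X\rangle^{\otimes n}\to M_d(F)^{\otimes n}$). For a partition $\lambda=(\lambda_1,\dots,\lambda_n)\vdash k$ with $n$ parts, set $X_j:=x_{\lambda_1+\dots+\lambda_{j-1}+1}\cdots x_{\lambda_1+\dots+\lambda_j}$ and $ST(\lambda):=\sum_{\sigma\in S_k}\epsilon_\sigma (X_1\otimes\cdots\otimes X_n)(x_{\sigma(1)},\dots,x_{\sigma(k)})\in F\langle X\rangle^{\otimes n}$, i.e. the alternation of $X_1\otimes\cdots\otimes X_n$ over the variables $x_1,\dots,x_k$. For partitions $\lambda,\mu$, $\lambda\oplus\mu$ is the partition whose parts are those of $\lambda$ together with those of $\mu$, arranged non-increasingly; $1^r$ is the partition with $r$ parts equal to $1$ (empty if $r=0$). For a partition $\mu=(\mu_1,\dots,\mu_n)$ with $n$ parts and $\sigma\in S_n$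 with cycle decomposition $\sigma=c_1\cdots c_l$ (including fixed points as $1$-cycles), $\sigma(\mu)$ is the partition $(\sum_{i\in c_1}\mu_i,\dots,\sum_{i\in c_l}\mu_i)$ arranged non-increasingly. $\mu$ is a refinement of $\lambda$ if $\sigma(\mu)=\lambda$ for some $\sigma\in S_n$. *)

(* Defs.v *)
From HB Require Import structures.
From mathcomp Require Import all_boot all_order all_algebra all_fingroup.
Set Implicit Arguments. Unset Strict Implicit. Unset Printing Implicit Defensive.
Import GRing.Theory.
Local Open Scope ring_scope.

Definition is_partition (l : seq nat) : bool :=
  sorted geq l && all (fun x => 0 < x)%N l.

Definition pad_ones (l : seq nat) (r : nat) : seq nat := sort geq (l ++ nseq r 1%N).

Definition delta (d : nat) : seq nat := [seq (2 * (d - i) - 1)%N | i <- iota 0 d].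

Definition cycle_part (mu : seq nat) (s : 'S_(size mu)) : seq nat :=
  sort geq [seq (\sum_(i in c) nth 0%N mu (val i))%N | c : {set 'I_(size mu)} <- enum (porbits s)].

Definition refines (mu lam : seq nat) : Prop :=
  exists s : 'S_(size mu), cycle_part s = lam.

Definition perm_nat (k : nat) (s : 'S_k) (p : nat) : nat :=
  if insub p is Some i then val (s i) else p.

Definition block_start (l : seq nat) (j : nat) : nat := sumn (take j l).

Definition block_eval (F : fieldType) (d : nat) (l : seq nat) (s : 'S_(sumn l))
    (A : nat -> 'M[F]_d) (j : nat) : 'M[F]_d :=
  \prod_(p <- iota (block_start l j) (nth 0%N l j)) A (perm_nat s p).

(* Coordinates of ST(lambda)(A) in M_d(F)^{(x) n}, n = size l, w.r.t. the basis
   E_{i_1 j_1} (x) ... (x) E_{i_n j_n}; an index is f : 'I_n -> 'I_d * 'I_d.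
   The coordinate of B_1 (x) ... (x) B_n at f is prod_b (B_b) (f b).1 (f b).2. *)
Definition ST_coord (F : fieldType) (d : nat) (l : seq nat) (A : nat -> 'M[F]_d)
    (f : {ffun 'I_(size l) -> 'I_d * 'I_d}) : F :=
  \sum_(s : 'S_(sumn l)) (-1) ^+ odd_perm s *
     \prod_(b : 'I_(size l)) (block_eval s A b) (f b).1 (f b).2.

Definition ST_is_TPI (F : fieldType) (d : nat) (l : seq nat) : Prop :=
  forall (A : nat -> 'M[F]_d) (f : {ffun 'I_(size l) -> 'I_d * 'I_d}),
    ST_coord A f = 0.

(* Main.v *)
Require Import Defs.
From HB Require Import structures.
From mathcomp Require Import all_boot all_order all_algebra all_fingroup.
From mathcomp Require Import all_field.
From mathcomp Require Import zify.

(** Take a d x d matrix X whose d^2 entries are independent anticommuting variables. The tensor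
ST(lambda), evaluated at the elementary matrices, is read off from the entries of
X^(lambda_1) (x) ... (x) X^(lambda_n), and a padding by parts equal to 1 reduces everything to
the case k = d^2, where these entries are scalar multiples of the product omega of all
variables. As the adjoint representation is traceless, omega is annihilated by gl_d, so the
scalars form an invariant tensor with integer entries. An invariant tensor all of whose full
contractions vanish is zero: by induction its partial contractions vanish, and then the
Casimir element expresses a sum of squares of its gl_d-translates as zero.
The full contraction along sigma is, up to sign, the product of the traces of X^m over the
parts m of sigma(lambda). Here tr X^m = 0 for even m, the odd traces anticommute and hence
square to zero, and X^(2d) = 0 (Amitsur-Levitzki). So distinct odd parts below 2d and of sum d^2
are needed, which leaves only delta_d. The trace product of delta_d is nonzero because the
tensor of (1, ..., 1) is nonzero and therefore has some nonzero contraction. *)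

Set Implicit Arguments. Unset Strict Implicit. Unset Printing Implicit Defensive.
Import Order.TTheory GRing.Theory Num.Theory.
Local Open Scope ring_scope.

(** * Nilpotency from vanishing power traces *)

Lemma deriv_prod_seq (R : comNzRingType) (I : eqType) (s : seq I) (F : I -> {poly R}) :
  uniq s ->
  (\prod_(i <- s) F i)^`() = \sum_(i <- s) (F i)^`() * \prod_(j <- s | j != i) F j.
Proof.
elim: s => [|x s IHs] /=; first by rewrite !big_nil derivC.
case/andP=> xs us; rewrite big_cons derivM IHs // big_cons big_cons eqxx /=.
congr (_ * _ + _).
  rewrite [RHS]big_seq_cond [LHS]big_seq; apply: eq_bigl => j.
  by case: (boolP (j \in s)) => //= js; apply/esym; apply: contraNneq xs => <-.
rewrite mulr_sumr [LHS]big_seq [RHS]big_seq; apply: eq_bigr => i is_.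
rewrite big_cons ifT; first by rewrite mulrCA.
by apply: contraNneq xs => ->.
Qed.

(** Jacobi's formula: differentiating row i of x - A leaves the unit row e_i, and the resulting
    determinant is the i-th diagonal cofactor. *)
Lemma deriv_char_poly (R : comNzRingType) (n : nat) (A : 'M[R]_n) :
  (char_poly A)^`() = \tr (\adj (char_poly_mx A)).
Proof.
have dE (s : 'S_n) : deriv ((-1) ^+ s * \prod_i char_poly_mx A i (s i)) =
    \sum_i (-1) ^+ s * ((i == s i)%:R * \prod_(j | j != i) char_poly_mx A j (s j)).
  rewrite -(rmorph_sign polyC) deriv_mulC deriv_prod_seq ?index_enum_uniq //.
  rewrite mulr_sumr; apply: eq_bigr => i _; congr (_ * (_ * _)).
  rewrite !mxE derivB derivC subr0.
  by case: eqP => _; rewrite ?mulr1n ?mulr0n ?derivX ?derivC.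
rewrite /char_poly /determinant (big_morph _ (@derivD R) (@deriv0 R)) (eq_bigr _ (fun s _ => dE s)).
rewrite exchange_big /=; apply: eq_bigr => i _; rewrite [RHS]mxE.
have := expand_det_row (\matrix_(k, l) if k == i then (l == i)%:R else char_poly_mx A k l) i.
rewrite (bigD1 i) //= big1 ?addr0; last first.
  by move=> j ji; rewrite mxE eqxx (negbTE ji) mul0r.
rewrite mxE !eqxx mul1r => E.
transitivity (\det (\matrix_(k, l) (if k == i then (l == i)%:R else char_poly_mx A k l))).
  apply: eq_bigr => s _; congr (_ * _); rewrite [RHS](bigD1 i) //= mxE eqxx eq_sym; congr (_ * _).
  by apply: eq_bigr => j ji; rewrite mxE (negbTE ji).
rewrite {}E /cofactor; congr (_ * \det _); apply/matrixP => k l; rewrite !mxE.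
by rewrite eq_sym (negbTE (neq_lift _ _)).
Qed.

(* Taking traces in adj(x - Y) (x - Y) = p(x), with p the characteristic polynomial, gives
   x p'(x) = n p(x), whence p = x^n. *)
Lemma nilpotent_of_mxtrace_expr (R : comNzRingType) (n : nat) (Y : 'M[R]_n) :
  (forall (m : nat) (x : R), x *+ m.+1 = 0 -> x = 0) ->
  (forall j, \tr (Y ^+ j.+1) = 0) -> Y ^+ n = 0.
Proof.
case: n Y => [|n] Y tf tr0; first by apply/matrixP => -[].
pose B := \adj (char_poly_mx Y); pose p := char_poly Y.
pose Yp := map_mx (@polyC R) Y.
have hB : 'X *: B = Yp *m B + p%:M.
  by rewrite -[p%:M](mul_mx_adj (char_poly_mx Y)) mulmxBl mul_scalar_mx addrC subrK.
have YpX j : Yp ^+ j = map_mx (@polyC R) (Y ^+ j) by rewrite [RHS]rmorphXn.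
have step j : 'X * \tr (Yp ^+ j.+1 *m B) = \tr (Yp ^+ j.+2 *m B).
  rewrite -linearZ /= scalemxAr hB mulmxDr linearD /= mulmxA -[_ *m Yp]/(_ * Yp) -exprSr.
  by rewrite mul_mx_scalar linearZ /= (YpX j.+1) trace_map_mx tr0 raddf0 mulr0 addr0.
have iterX m : \tr (Yp ^+ m.+1 *m B) = 'X^m * \tr (Yp *m B).
  elim: m => [|m IHm]; first by rewrite expr0 mul1r expr1.
  by rewrite -step IHm mulrA -exprS.
pose K := (\max_i \max_j size (B i j))%N.
have szK m : (size (\tr (Yp ^+ m.+1 *m B)) <= K)%N.
  rewrite /mxtrace; apply: leq_trans (size_sum _ _ _) _; apply/bigmax_leqP => i _.
  rewrite mxE; apply: leq_trans (size_sum _ _ _) _; apply/bigmax_leqP => j _.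
  rewrite YpX mxE mul_polyC; apply: leq_trans (size_scale_leq _ _) _.
  apply: leq_trans (leq_bigmax (F := fun j => \max_i size (B j i))%N j).
  exact: (leq_bigmax (F := fun i => size (B j i))).
(* In [iterX] the left side has size at most [K] for every m, the entries of powers of [Yp] being
   constants, while the right side grows with m unless this trace is zero. *)
have trYB : \tr (Yp *m B) = 0.
  apply/eqP/negPn/negP => nz; have := szK K.
  rewrite iterX mulrC size_mulXn // leqNgt => /negP; apply.
  by rewrite -[X in (X < _)%N]addn0 ltn_add2l size_poly_gt0.
have hp : 'X * p^`() = p *+ n.+1.
  by rewrite deriv_char_poly -linearZ /= -/B hB linearD /= trYB add0r mxtrace_scalar.
have pX : p = 'X^(n.+1).
  have mp := char_poly_monic Y; have sp := size_char_poly Y.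
  apply/polyP => i; rewrite coefXn.
  case: (ltngtP i n.+1) => [lt_i|gt_i|->]; last 2 first.
  - by rewrite nth_default // sp.
  - by have /monicP := mp; rewrite /lead_coef sp.
  have /(congr1 (fun q : {poly R} => q`_i)) := hp; rewrite coefXM coefMn.
  have -> : (if i == 0 then 0 else p^`()`_i.-1) = p`_i *+ i.
    by case: i {lt_i} => [|i] //=; rewrite coef_deriv.
  move/esym/eqP; rewrite -subr_eq0 -mulrnBr; last exact: ltnW.
  by rewrite -(subnSK lt_i) => /eqP /tf ->.
have := Cayley_Hamilton Y; rewrite -/p pX rmorphXn /= horner_mx_X. by [].
Qed.

(** * Matrices with anticommuting entries *)

Lemma mulr_signCA (R : pzRingType) (n : nat) (x y : R) : x * ((-1) ^+ n * y) = (-1) ^+ n * (x * y).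
Proof. by rewrite mulrA commr_sign mulrA. Qed.

Lemma signed_comm_prod (R : pzRingType) (I : Type) (s : seq I) (m : I -> nat) (a : nat) (x : R)
    (u : I -> R) :
  (forall i, x * u i = (-1) ^+ (a * m i) * (u i * x)) ->
  x * \prod_(i <- s) u i = (-1) ^+ (a * \sum_(i <- s) m i) * ((\prod_(i <- s) u i) * x).
Proof.
move=> xu; elim: s => [|i s IHs]; first by rewrite !big_nil muln0 expr0 !mul1r mulr1.
rewrite !big_cons mulnDr exprD mulrA xu -!mulrA IHs; congr (_ * _).
by rewrite !mulrA commr_sign.
Qed.

(* The sign depends on the degrees [m] only. *)
Lemma perm_signed_prod (I : eqType) (s t : seq I) (m : I -> nat) :
  perm_eq s t -> exists b : bool, forall (R : pzRingType) (u : I -> R),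
    (forall i j, u i * u j = (-1) ^+ (m i * m j) * (u j * u i)) ->
    \prod_(i <- s) u i = (-1) ^+ b * \prod_(i <- t) u i.
Proof.
elim: s t => [|x s IHs] t pst.
  by exists false => R u _; move: pst; rewrite perm_sym => /perm_nilP ->; rewrite mul1r.
have xt : x \in t by rewrite -(perm_mem pst) mem_head.
case/splitPr: xt pst => t1 t2; rewrite -[x :: t2]cat1s perm_sym perm_catCA cat1s perm_cons perm_sym.
case/IHs => b hb.
exists (b (+) odd (m x * \sum_(i <- t1) m i)) => R u hu.
rewrite big_cons (hb _ _ hu) /= !big_cat big_cons /= signr_addb signr_odd.
have hx := @signed_comm_prod R I t1 m (m x) (u x) u (hu x).
by rewrite mulr_signCA [X in _ * X]mulrA hx -!mulrA.
Qed.

Section SignedMatrix.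
Variables (R : pzRingType) (d : nat) (X : 'M[R]_d).
Hypothesis antiX : forall i j k l, X i j * X k l = - (X k l * X i j).

Lemma signed_comm_mxexp (a b : nat) (u : R) k l :
  (forall i j, u * X i j = (-1) ^+ a * (X i j * u)) ->
  u * (X ^+ b) k l = (-1) ^+ (a * b) * ((X ^+ b) k l * u).
Proof.
move=> hu; elim: b k l => [|b IHb] k l.
  by rewrite muln0 !mul1r expr0 !mxE; case: (k == l); rewrite ?mulr1n ?mulr0n ?mulr1 ?mul1r ?mulr0 ?mul0r.
rewrite exprSr [(X ^+ b * X) k l]mxE mulr_sumr mulr_suml mulr_sumr; apply: eq_bigr => i _.
rewrite mulrA IHb -!mulrA hu mulnS addnC exprD -mulrA; congr (_ * _).
by rewrite !mulrA commr_sign.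
Qed.

Lemma mxexp_signed_comm a b i j k l :
  (X ^+ a) i j * (X ^+ b) k l = (-1) ^+ (a * b) * ((X ^+ b) k l * (X ^+ a) i j).
Proof.
apply: signed_comm_mxexp => p q.
have := @signed_comm_mxexp 1 a (X p q) i j; rewrite mul1n => ->; last first.
  by move=> p' q'; rewrite antiX expr1 mulN1r.
by rewrite mulrA -exprD addnn -muln2 mulnC exprM sqrrN expr1n expr1n mul1r.
Qed.

Lemma mxtrace_expr_signed_comm a b :
  \tr (X ^+ a) * \tr (X ^+ b) = (-1) ^+ (a * b) * (\tr (X ^+ b) * \tr (X ^+ a)).
Proof.
rewrite /mxtrace !mulr_suml !mulr_sumr.
under eq_bigr do rewrite mulr_sumr; under [RHS]eq_bigr do rewrite !mulr_sumr.
rewrite exchange_big /=; apply: eq_bigr => i _; apply: eq_bigr => j _.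
exact: mxexp_signed_comm.
Qed.

Hypothesis two_inj : forall x : R, x + x = 0 -> x = 0.

(** Moving one factor X to the other end of the trace passes an odd number of anticommuting factors,
    so the trace equals its own negative. *)
Lemma mxtrace_expr_even a : (0 < a)%N -> ~~ odd a -> \tr (X ^+ a) = 0.
Proof.
case: a => // a _ /= oa; apply: two_inj; apply/eqP; rewrite addr_eq0; apply/eqP.
rewrite {1}exprS exprSr /mxtrace.
transitivity (\sum_i \sum_j X i j * (X ^+ a) j i); first by apply: eq_bigr => i _; rewrite mxE.
rewrite exchange_big -sumrN; apply: eq_bigr => i _; rewrite mxE -sumrN; apply: eq_bigr => j _.
have := mxexp_signed_comm 1 a j i i j; rewrite !expr1 mul1n => ->.
by rewrite -signr_odd; case: (odd a) oa => // _; rewrite expr1 mulN1r.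
Qed.

Lemma mxtrace_expr_odd_sqr a : odd a -> \tr (X ^+ a) * \tr (X ^+ a) = 0.
Proof.
move=> oa; apply: two_inj; apply/eqP; rewrite addr_eq0; apply/eqP.
by rewrite {1}mxtrace_expr_signed_comm -signr_odd oddM oa expr1 mulN1r.
Qed.

End SignedMatrix.

(** * The Amitsur-Levitzki theorem for an anticommuting matrix *)

Section AmitsurLevitzki.
Variables (K : fieldType) (L : falgType K) (d : nat) (X : 'M[L]_d).
Hypothesis chK : [pchar K] =i pred0.
Hypothesis antiX : forall i j k l, X i j * X k l = - (X k l * X i j).

Lemma lmod_mulrn_eq0 (V : lmodType K) (m : nat) (x : V) : x *+ m.+1 = 0 -> x = 0.
Proof.
move/eqP; rewrite -scaler_nat scaler_eq0 => /orP[|/eqP //].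
by have /pcharf0P -> := chK.
Qed.

(* Rosset's argument: the entries of X^2 commute and the traces of its powers vanish. *)
Lemma anticommuting_mxexp_eq0 : (0 < d)%N -> X ^+ (2 * d) = 0.
Proof.
move=> d0; pose Y := X ^+ 2.
have commY i j k l : Y i j * Y k l = Y k l * Y i j.
  by rewrite (mxexp_signed_comm antiX) -signr_odd expr0 mul1r.
pose ys := [seq Y p.1 p.2 | p : 'I_d * 'I_d]; pose U := <<ys>>%VS.
have YU i j : Y i j \in U by apply/memv_span/mapP; exists (i, j); rewrite ?mem_enum.
(* As the entries of Y commute pairwise, [U] lies in its own centraliser; its double centraliser is
   then a commutative algebra containing these entries, over which characteristic polynomials are
   available. *)
pose C := ('C('C(U)))%AS.
have UCU : (U <= 'C(U))%VS.
  apply/span_subvP => _ /mapP[[i j] _ ->]; apply/centvP => u uU /=.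
  move: u uU; have: (U <= 'C[Y i j])%VS.
    apply/span_subvP => _ /mapP[[k l] _ ->]; apply/cent1vP => /=; exact: commY.
  by move/subvP => h u /h /cent1vP.
have commC (u v : L) : u \in C -> v \in C -> u * v = v * u.
  move=> /centvP uC /centvP vC; apply: uC.
  by apply/centvP => w wU; rewrite vC //; apply: subvP UCU _ _.
have mulC : commutative (@GRing.mul (subvs_of C)).
  by move=> u v; apply/val_inj; apply: commC; apply: subvsP.
pose R : comNzRingType :=
  HB.pack (subvs_of C) (GRing.PzRing_hasCommutativeMul.Build (subvs_of C) mulC).
have YC i j : Y i j \in C.
  by apply/centvP => u /centvP uU; apply/esym; apply: uU.
pose Y' : 'M[R]_d := \matrix_(i, j) (Subvs (YC i j) : R).
have Y'X j i k : vsval ((Y' ^+ j.+1) i k) = (Y ^+ j.+1) i k.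
  elim: j i k => [|j IHj] i k; first by rewrite !mxE.
  rewrite exprS [in RHS]exprS !mxE raddf_sum; apply: eq_bigr => l _.
  by rewrite -IHj mxE.
have Y'0 : Y' ^+ d = 0.
  apply: nilpotent_of_mxtrace_expr => [m x|j]; first exact: (@lmod_mulrn_eq0 (subvs_of C)).
  apply: val_inj; have -> : val (\tr (Y' ^+ j.+1)) = \tr (Y ^+ j.+1).
    by rewrite /mxtrace raddf_sum; apply: eq_bigr => i _; apply: Y'X.
  rewrite -exprM mxtrace_expr_even ?oddM //.
  by move=> x; apply: (@lmod_mulrn_eq0 L 1).
have Y'd i k : vsval ((Y' ^+ d) i k) = (Y ^+ d) i k by have := Y'X d.-1 i k; rewrite prednK.
by rewrite exprM -/Y; apply/matrixP => i j; rewrite -Y'd Y'0 !mxE linear0.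
Qed.

End AmitsurLevitzki.

(** * A matrix model of the Grassmann algebra *)

Section JordanWigner.
Variable K : fieldType.

(** This is 2^n - 1, written so that [(jw_dim m.+1).+1] is convertible to the sum of two copies of
    [(jw_dim m).+1], the size of a [block_mx]. *)
Fixpoint jw_dim (n : nat) : nat := if n is m.+1 then (jw_dim m + (jw_dim m).+1)%N else 0%N.

(** Tensor product with a 2 x 2 matrix: E_12 for the newest generator, diag(1, -1) for an older one,
    whose sign makes the two anticommute. *)
Definition jw_block (m : nat) (A : 'M[K]_(m.+1)) (last : bool) : 'M[K]_(m.+1 + m.+1) :=
  if last then block_mx 0 1%:M 0 0 else block_mx A 0 0 (- A).

(* The Jordan-Wigner matrices: creation operators on the Fock space of dimension 2^n, whose
   transposes are the annihilation operators. *)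
Fixpoint jw (n p : nat) : 'M[K]_((jw_dim n).+1) :=
  if n is m.+1 then jw_block (jw m p) (p == m) else 0.

Definition block_simp := (@mulmx_block, @mulmx0, @mul0mx, @mulmx1, @mul1mx, @mulmxN, @mulNmx,
  @addr0, @add0r, @opprK, @oppr0, @opp_block_mx, @tr_block_mx, @trmx0, @trmx1, @add_block_mx,
  @addNr, @addrN).

Lemma jw_anticomm n p q : jw n p * jw n q = - (jw n q * jw n p).
Proof.
elim: n => [|m IHm]; first by rewrite !mul0r oppr0.
rewrite -[LHS]/(jw_block (jw m p) (p == m) *m jw_block (jw m q) (q == m)).
rewrite -[RHS]/(- (jw_block (jw m q) (q == m) *m jw_block (jw m p) (p == m))).
rewrite -!mulmxE in IHm; rewrite /jw_block.
by case: eqP => _; case: eqP => _; rewrite !block_simp // IHm ?opprK.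
Qed.

Lemma jw_sqr n p : jw n p * jw n p = 0.
Proof.
elim: n => [|m IHm]; first by rewrite mul0r.
rewrite -[LHS]/(jw_block (jw m p) (p == m) *m jw_block (jw m p) (p == m)).
rewrite -!mulmxE in IHm; rewrite /jw_block.
by case: eqP => _; rewrite !block_simp ?IHm block_mx0.
Qed.

(** The canonical anticommutation relations. Through them, creation after annihilation acts on the
    generators as a substitution derivation. *)
Lemma jw_trmx_anticomm n p q : (q < n)%N ->
  jw n p * (jw n q)^T + (jw n q)^T * jw n p = (p == q)%:R%:M.
Proof.
elim: n => [//|m IHm]; rewrite ltnS leq_eqVlt => qm.
rewrite -[LHS]/(jw_block (jw m p) (p == m) *m (jw_block (jw m q) (q == m))^T +
  (jw_block (jw m q) (q == m))^T *m jw_block (jw m p) (p == m)).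
rewrite -!mulmxE in IHm; rewrite /jw_block.
have [Eq|nq] := eqVneq q m; have [Ep|np] := eqVneq p m; rewrite !(block_simp, linearN).
- by rewrite Ep Eq eqxx -scalar_mx_block.
- by rewrite Eq (negbTE np) raddf0 block_mx0.
- by rewrite Ep eq_sym (negbTE nq) raddf0 block_mx0.
- by rewrite (negbTE nq) /= in qm; rewrite IHm // -scalar_mx_block.
Qed.

(** The product of the older generators is block diagonal, and the last generator moves its upper
    left block, nonzero by induction, to the upper right corner. *)
Lemma jw_prod_iota_neq0 n : \prod_(p <- iota 0 n) jw n p != 0.
Proof.
elim: n => [|m IHm]; first by rewrite big_nil oner_neq0.
rewrite -[m.+1]addn1 iotaD add0n big_cat big_seq1 /= addn1.
set n := (jw_dim m).+1.
have diagM (A B C D : 'M[K]_n) :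
    block_mx A 0 0 B *m block_mx C 0 0 D = block_mx (A *m C) 0 0 (B *m D).
  by rewrite !block_simp.
have diagU (A B : 'M[K]_n) : block_mx A 0 0 B *m block_mx (0 : 'M_n) 1%:M 0 0 = block_mx 0 A 0 0.
  by rewrite !block_simp.
have -> : \prod_(p <- iota 0 m) jw m.+1 p =
    block_mx (\prod_(p <- iota 0 m) jw m p) 0 0 (\prod_(p <- iota 0 m) - jw m p)
    :> 'M[K]_(n + n).
  have : m \notin iota 0 m by rewrite mem_iota add0n ltnn.
  elim: (iota 0 m) => [_|p s IHs]; first by rewrite !big_nil -scalar_mx_block.
  rewrite inE negb_or !big_cons => /andP[mp ms]; rewrite {}IHs //.
  rewrite -[jw m.+1 p]/(jw_block (jw m p) (p == m)) eq_sym (negbTE mp).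
  exact: diagM.
rewrite -[jw m.+1 m]/(jw_block (jw m m) (m == m)) eqxx.
apply: contra_neq IHm => /(etrans (esym (diagU _ _))) /eqP.
by rewrite block_mx_eq0 => /and4P[_ /eqP -> _ _].
Qed.
End JordanWigner.

(** * Signs of rearranged products of anticommuting elements *)

Section AnticommutingWords.
Variables (L : pzRingType) (I : eqType) (e : I -> L).
Hypothesis e_anti : forall i j, e i * e j = - (e j * e i).

Lemma anticomm_degree1 i j : e i * e j = (-1) ^+ (1 * 1) * (e j * e i).
Proof. by rewrite muln1 expr1 mulN1r. Qed.

Lemma perm_anticomm_prod (s t : seq I) : perm_eq s t ->
  exists b : bool, \prod_(i <- s) e i = (-1) ^+ b * \prod_(i <- t) e i.
Proof.
case/(perm_signed_prod (fun=> 1%N)) => b hb; exists b; apply: hb => i j.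
exact: anticomm_degree1.
Qed.

Hypothesis e_sqr : forall i, e i * e i = 0.

Lemma anticomm_prod_nuniq (s : seq I) : ~~ uniq s -> \prod_(i <- s) e i = 0.
Proof.
elim: s => [//|x s IHs] /=; rewrite negb_and negbK big_cons => /orP[xs|/IHs ->]; last by rewrite mulr0.
have [b ->] := perm_anticomm_prod (perm_to_rem xs).
by rewrite big_cons mulr_signCA [e x * _]mulrA e_sqr mul0r mulr0.
Qed.
End AnticommutingWords.

Section AnticommutingPerm.
Variables (L : pzRingType) (k : nat).

(** Both letters cross the block [s2] between them, with signs that cancel; the sign from crossing
    each other remains. *)
Lemma anticomm_prod_tperm (e : 'I_k -> L) (x y : 'I_k) : (forall i j, e i * e j = - (e j * e i)) -> x != y ->
  \prod_i e (tperm x y i) = - \prod_i e i.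
Proof.
move=> e_anti; wlog [s1 [s2 [s3 Es]]] : x y / exists s1 s2 s3, index_enum 'I_k = s1 ++ x :: s2 ++ y :: s3.
  have split_at (s : seq 'I_k) z : z \in s -> exists a b, s = a ++ z :: b.
    by case/splitPr => a b; exists a, b.
  move=> W xy; have [s1 [s2 Es]] := split_at _ x (mem_index_enum x).
  have : y \in s1 ++ x :: s2 by rewrite -Es mem_index_enum.
  rewrite mem_cat inE eq_sym (negbTE xy) /= => /orP[] /split_at[t1 [t2 E]].
    rewrite tpermC; apply: W; last by rewrite eq_sym.
    by exists t1, t2, s2; rewrite Es E -catA.
  by apply: W => //; exists s1, t1, t2; rewrite Es E.
have := index_enum_uniq 'I_k; rewrite Es => us xy.
have fix_s (s : seq 'I_k) : x \notin s -> y \notin s -> \prod_(i <- s) e (tperm x y i) = \prod_(i <- s) e i.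
  move=> xs ys; rewrite big_seq [RHS]big_seq; apply: eq_bigr => i is_.
  by rewrite tpermD //; apply: contraTneq is_ => <-.
move: us; rewrite cat_uniq /= cat_uniq /= !mem_cat !inE !has_cat !negb_or /=.
case/and5P=> _ /and4P[x1 _ y1 _] /and3P[x2 _ x3] _ /and3P[/andP[y2 _] y3 _].
rewrite !(big_cat, big_cons) /= tpermL tpermR !fix_s //.
have eP i : e i * \prod_(j <- s2) e j = (-1) ^+ size s2 * (\prod_(j <- s2) e j * e i).
  have := @signed_comm_prod L _ s2 (fun=> 1%N) 1 (e i) e (anticomm_degree1 e_anti i).
  by rewrite big_const_seq count_predT iter_addn_0 !mul1n.
rewrite -mulrN -[in RHS]mulNr; congr (_ * _); rewrite !mulrA; congr (_ * _).
by rewrite !mulNr !eP -!mulrA (e_anti y x) !mulrN.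
Qed.

Lemma anticomm_prod_perm (e : 'I_k -> L) (s : 'S_k) : (forall i j, e i * e j = - (e j * e i)) ->
  \prod_i e (s i) = (-1) ^+ s * \prod_i e i.
Proof.
case: (prod_tpermP s) => ts -> {s}; elim: ts e => [|t ts IHts] e /=.
  by move=> _ _; rewrite !big_nil odd_perm1 mul1r; apply: eq_bigr => i _; rewrite perm1.
case/andP => dt dts e_anti; rewrite !big_cons odd_mul_tperm dt /=.
under eq_bigr do rewrite permM.
rewrite (anticomm_prod_tperm (e := fun i => e ((\prod_(t0 <- ts) tperm t0.1 t0.2)%g i))) //.
by rewrite IHts // signrN mulNr.
Qed.
End AnticommutingPerm.

Section Words.
Variable Q : finType.

Fixpoint wsum (V : nmodType) (m : nat) (F : seq Q -> V) : V :=
  if m is m'.+1 then \sum_q wsum m' (fun w => F (q :: w)) else F [::].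

Lemma eq_wsum (V : nmodType) m (F G : seq Q -> V) :
  (forall w, size w = m -> F w = G w) -> wsum m F = wsum m G.
Proof.
elim: m F G => [|m IHm] F G FG /=; first exact: FG.
by apply: eq_bigr => q _; apply: IHm => w sw; apply: FG; rewrite /= sw.
Qed.

Lemma wsum_cat (V : nmodType) a b (F : seq Q -> V) :
  wsum (a + b) F = wsum a (fun u => wsum b (fun v => F (u ++ v))).
Proof. by elim: a F => [|a IHa] F //=; apply: eq_bigr => q _; rewrite IHa. Qed.

Lemma wsum_sum (V : nmodType) (I : finType) m (F : I -> seq Q -> V) :
  \sum_i wsum m (F i) = wsum m (fun w => \sum_i F i w).
Proof.
elim: m F => [|m IHm] F //=; rewrite exchange_big; apply: eq_bigr => q _.
by rewrite IHm.
Qed.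

Lemma mulr_wsumr (R : pzRingType) m (x : R) (F : seq Q -> R) :
  x * wsum m F = wsum m (fun w => x * F w).
Proof. by elim: m F => [|m IHm] F //=; rewrite mulr_sumr; apply: eq_bigr => q _; rewrite IHm. Qed.

Lemma mulr_wsuml (R : pzRingType) m (x : R) (F : seq Q -> R) :
  wsum m F * x = wsum m (fun w => F w * x).
Proof. by elim: m F => [|m IHm] F //=; rewrite mulr_suml; apply: eq_bigr => q _; rewrite IHm. Qed.

Lemma wsum_ffun (V : nmodType) m (F : seq Q -> V) :
  wsum m F = \sum_(g : {ffun 'I_m -> Q}) F (codom g).
Proof.
elim: m F => [|m IHm] F /=.
  rewrite (big_pred1 [ffun i : 'I_0 => match notF (ltn_ord i) with end]).
    by congr F; apply/esym/size0nil; rewrite size_codom card_ord.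
  by move=> g /=; apply/esym/eqP/ffunP => -[].
under eq_bigr do rewrite IHm.
pose h (p : Q * {ffun 'I_m -> Q}) : {ffun 'I_m.+1 -> Q} :=
  [ffun i => if unlift ord0 i is Some j then p.2 j else p.1].
pose h' (g : {ffun 'I_m.+1 -> Q}) := (g ord0, [ffun j => g (lift ord0 j)]).
rewrite pair_bigA (reindex h) /=; last first.
  exists h' => [[q g]|g] _.
    rewrite /h' /h !ffunE unlift_none; congr pair; apply/ffunP => j.
    by rewrite !ffunE liftK.
  by apply/ffunP => i; rewrite !ffunE; case: unliftP => [j ->|->] //=; rewrite ffunE.
apply: eq_bigr => -[q g] _; congr F; rewrite /= !codomE enum_ordSl /= ffunE unlift_none.
by congr cons; rewrite -map_comp; apply: eq_map => j /=; rewrite ffunE liftK.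
Qed.
End Words.

(** * Expansion of products of matrix powers *)

(* A tensor coordinate is encoded as a list of pairs (m, (i, j)): block length and matrix entry.
   The word w is cut into blocks of these lengths. *)
Fixpoint block_coef (R : pzRingType) (d : nat) (Q : Type) (A : Q -> 'M[R]_d)
    (z : seq (nat * ('I_d * 'I_d))) (w : seq Q) : R :=
  if z is t :: z' then
    (\prod_(q <- take t.1 w) A q) t.2.1 t.2.2 * block_coef A z' (drop t.1 w)
  else 1.

Definition alt_coef (R : pzRingType) (d k : nat) (A : 'I_k -> 'M[R]_d)
    (z : seq (nat * ('I_d * 'I_d))) : R :=
  \sum_(s : 'S_k) (-1) ^+ s * block_coef A z (codom s).

Definition entry_prod (R : pzRingType) (d : nat) (X : 'M[R]_d) (z : seq (nat * ('I_d * 'I_d))) : R :=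
  \prod_(t <- z) (X ^+ t.1) t.2.1 t.2.2.

Lemma block_coef_map (R : pzRingType) d (Q Q' : Type) (h : Q' -> Q) (A : Q -> 'M[R]_d) z w :
  block_coef (fun q => A (h q)) z w = block_coef A z (map h w).
Proof. by elim: z w => [|t z IHz] w //=; rewrite IHz -map_take -map_drop big_map. Qed.

Lemma eq_block_coef (R : pzRingType) d (Q : Type) (A A' : Q -> 'M[R]_d) z w :
  A =1 A' -> block_coef A z w = block_coef A' z w.
Proof.
move=> AA'; elim: z w => [|t z IHz] w //=; rewrite IHz; congr (fun_of_matrix _ _ _ * _).
by apply: eq_bigr => q _; apply: AA'.
Qed.

Lemma eq_alt_coef (R : pzRingType) d k (A A' : 'I_k -> 'M[R]_d) z :
  A =1 A' -> alt_coef A z = alt_coef A' z.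
Proof. by move=> AA'; apply: eq_bigr => s _; rewrite (eq_block_coef _ _ AA'). Qed.

Lemma rmorph_block_coef (R S : pzRingType) (f : {rmorphism R -> S}) d (Q : Type)
    (A : Q -> 'M[R]_d) z w :
  f (block_coef A z w) = block_coef (fun q => map_mx f (A q)) z w.
Proof.
elim: z w => [|t z IHz] w /=; first exact: rmorph1.
rewrite rmorphM IHz; congr (_ * _).
have -> : \prod_(q <- take t.1 w) map_mx f (A q) = map_mx f (\prod_(q <- take t.1 w) A q).
  elim: (take _ _) => [|q u IHu]; first by rewrite !big_nil map_mx1.
  by rewrite !big_cons IHu -!mulmxE map_mxM.
by rewrite mxE.
Qed.

Lemma rmorph_alt_coef (R S : pzRingType) (f : {rmorphism R -> S}) d k (A : 'I_k -> 'M[R]_d) z :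
  f (alt_coef A z) = alt_coef (fun q => map_mx f (A q)) z.
Proof.
rewrite /alt_coef rmorph_sum; apply: eq_bigr => s _.
by rewrite rmorphM rmorph_sign rmorph_block_coef.
Qed.

(** A contributing [h] is injective with image inside that of [g], hence it is [g] composed with a
    unique permutation. *)
Lemma sum_ffun_perm (V : nmodType) (k : nat) (Q : finType) (g : 'I_k -> Q)
    (F : {ffun 'I_k -> Q} -> V) : injective g ->
  (forall h, F h != 0 -> injective h /\ {subset codom h <= codom g}) ->
  \sum_h F h = \sum_(s : 'S_k) F [ffun i => g (s i)].
Proof.
move=> g_inj hF; pose phi (s : 'S_k) := [ffun i => g (s i)].
rewrite (bigID (mem (phi @: setT))) /= addrC big1 ?add0r.
  rewrite big_imset /=; first by apply: eq_bigl => s; rewrite inE.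
  move=> s t _ _ /ffunP st; apply/permP => i; apply: g_inj.
  by have := st i; rewrite !ffunE.
move=> h hn; apply/eqP; apply: contraNT hn => /hF[h_inj hg].
have gi i : h i \in codom g by apply: hg; apply: codom_f.
have s_inj : injective (fun i => iinv (gi i)).
  by move=> i j /(congr1 g); rewrite !f_iinv => /h_inj.
apply/imsetP; exists (perm s_inj) => //; apply/ffunP => i.
by rewrite ffunE permE f_iinv.
Qed.

Lemma big_prod_codom (R : pzRingType) (I : finType) (Q : Type) (h : I -> Q) (e : Q -> R) :
  \prod_(q <- codom h) e q = \prod_i e (h i).
Proof. by rewrite codomE big_map [index_enum I]unlock -enumT. Qed.

Lemma codom_ffun_perm (k : nat) (Q : finType) (g : 'I_k -> Q) (s : 'S_k) :
  codom [ffun i => g (s i)] = map g (codom s).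
Proof.
by rewrite !codomE -[RHS]map_comp; apply: eq_map => i; rewrite ffunE.
Qed.

Section Expansion.
Variables (K : fieldType) (L : algType K) (d : nat) (Q : finType).
Variables (A : Q -> 'M[K]_d) (e : Q -> L) (X : 'M[L]_d).
Hypothesis XE : forall i j, X i j = \sum_q A q i j *: e q.

Lemma mxexp_expand a i j :
  (X ^+ a) i j = wsum a (fun w => (\prod_(q <- w) A q) i j *: \prod_(q <- w) e q).
Proof.
elim: a i j => [|a IHa] i j /=.
  by rewrite !big_nil expr0 !mxE; case: (i == j); rewrite ?scale1r ?scale0r.
rewrite exprS mxE; under [LHS]eq_bigr do rewrite XE IHa mulr_suml.
rewrite exchange_big; apply: eq_bigr => q _ /=.
under [LHS]eq_bigr do rewrite mulr_wsumr.
rewrite wsum_sum; apply: eq_wsum => w _; rewrite !big_cons mxE scaler_suml.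
by apply: eq_bigr => l _; rewrite -scalerAl -scalerAr scalerA.
Qed.

Lemma entry_prod_expand z :
  entry_prod X z = wsum (sumn (unzip1 z)) (fun w => block_coef A z w *: \prod_(q <- w) e q).
Proof.
elim: z => [|[a [i j]] z IHz] /=.
  by rewrite /entry_prod !big_nil scale1r.
rewrite /entry_prod big_cons -/(entry_prod X z) {}IHz mxexp_expand wsum_cat mulr_wsuml.
apply: eq_wsum => u su; rewrite mulr_wsumr; apply: eq_wsum => v _.
rewrite take_size_cat // drop_size_cat // big_cat /=.
by rewrite -scalerAl -scalerAr scalerA.
Qed.

Hypothesis e_anti : forall p q, e p * e q = - (e q * e p).

(** The factor [r] annihilates every word except rearrangements of [g], and sorting a rearrangement
    produces exactly the sign in the alternation. *)
Lemma entry_prod_top (z : seq (nat * ('I_d * 'I_d))) (g : 'I_(sumn (unzip1 z)) -> Q) (r : L) :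
  injective g ->
  (forall h : {ffun 'I_(sumn (unzip1 z)) -> Q}, (\prod_i e (h i)) * r != 0 ->
     injective h /\ {subset codom h <= codom g}) ->
  entry_prod X z * r = alt_coef (fun i => A (g i)) z *: ((\prod_i e (g i)) * r).
Proof.
move=> g_inj hr; rewrite entry_prod_expand mulr_wsuml wsum_ffun.
have hc (h : {ffun 'I_(sumn (unzip1 z)) -> Q}) : \prod_(q <- codom h) e q = \prod_i e (h i).
  by rewrite big_prod_codom.
rewrite (sum_ffun_perm g_inj); last first.
  move=> h; rewrite hc -scalerAl => nz; apply: hr.
  by apply: contraNneq nz => ->; rewrite scaler0.
rewrite /alt_coef scaler_suml; apply: eq_bigr => s _.
rewrite hc -scalerAl mulrC -scalerA; congr (_ *: _).
  by rewrite (block_coef_map g); congr block_coef; apply: codom_ffun_perm.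
under eq_bigr do rewrite ffunE.
rewrite (anticomm_prod_perm (e := fun i => e (g i))) //.
by rewrite mulr_sign scaler_sign; case: ifP => _; rewrite ?mulNr.
Qed.

(** Averaging the expansion over all relabellings of positions replaces plain coefficients by
    alternated ones. In characteristic 0, a nonzero entry product therefore has a nonzero alternated
    coefficient at some family of the matrices [A]. *)
Lemma entry_prod_sym (z : seq (nat * ('I_d * 'I_d))) (k := sumn (unzip1 z)) :
  entry_prod X z *+ k`! =
    \sum_(h : {ffun 'I_k -> Q}) alt_coef (fun i => A (h i)) z *: \prod_i e (h i).
Proof.
under eq_bigr do rewrite /alt_coef scaler_suml.
rewrite exchange_big /=; transitivity (\sum_(s : 'S_k) entry_prod X z).
  by rewrite sumr_const card_Sn.
apply: eq_bigr => s _; rewrite entry_prod_expand wsum_ffun.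
pose pre (t : 'S_k) (h : {ffun 'I_k -> Q}) := [ffun i => h (t i)].
rewrite (reindex (pre s)); last first.
  by exists (pre s^-1%g) => h _; apply/ffunP => i; rewrite !ffunE ?permK ?permKV.
apply: eq_bigr => h _; rewrite big_prod_codom codom_ffun_perm.
under eq_bigr do rewrite ffunE.
rewrite (anticomm_prod_perm (e := fun i => e (h i))) // (block_coef_map h).
by rewrite mulr_sign [(-1) ^+ s * _]mulr_sign; case: ifP => _; rewrite ?scalerN ?scaleNr.
Qed.
End Expansion.

(** * Coordinates of ST(lambda) as alternated coefficients *)

Section STCoordinates.
Variables (F : fieldType) (d : nat) (l : seq nat).

Definition coord_seq (f : {ffun 'I_(size l) -> 'I_d * 'I_d}) : seq (nat * ('I_d * 'I_d)) :=
  [seq (nth 0%N l (val i), f i) | i <- enum 'I_(size l)].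

Lemma coord_seq_parts f : unzip1 (coord_seq f) = l.
Proof.
rewrite /unzip1 -map_comp; apply: (@eq_from_nth _ 0%N); rewrite size_map size_enum_ord // => i il.
by rewrite (nth_map (Ordinal il)) ?size_enum_ord //= nth_enum_ord.
Qed.

Lemma coord_seq_surj (z : seq (nat * ('I_d * 'I_d))) : unzip1 z = l -> exists f, coord_seq f = z.
Proof.
move=> zl; have sz : size z == size l by rewrite -zl size_map.
pose t := Tuple sz; exists [ffun i => (tnth t i).2].
apply: (etrans _ (map_tnth_enum t)); apply: eq_map => i; rewrite ffunE.
rewrite -[X in nth _ X]zl (nth_map (tnth t i)) ?(eqP sz) ?ltn_ord // -[nth _ z _]/(nth _ t _).
by rewrite -tnth_nth -surjective_pairing.
Qed.

Lemma block_coefE (R : pzRingType) (Q : Type) (A : Q -> 'M[R]_d) (z : seq (nat * ('I_d * 'I_d))) z0 w :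
  block_coef A z w = \prod_(0 <= b < size z)
    (\prod_(q <- take (nth z0 z b).1 (drop (sumn (take b (unzip1 z))) w)) A q)
       (nth z0 z b).2.1 (nth z0 z b).2.2.
Proof.
elim: z w => [|t z IHz] w /=; first by rewrite big_nil.
rewrite big_nat_recl //= drop0 IHz; congr (_ * _); apply: eq_bigr => b _.
by rewrite drop_drop addnC.
Qed.

Lemma ST_coord_alt (A : nat -> 'M[F]_d) (f : {ffun 'I_(size l) -> 'I_d * 'I_d}) :
  ST_coord A f = alt_coef (fun i : 'I_(sumn l) => A i) (coord_seq f).
Proof.
apply: eq_bigr => s _; congr (_ * _).
(* The empty partition is treated apart, having no index from which to build the default [z0]. *)
have [l0|l1] := posnP (size l).
  have -> : coord_seq f = [::] by apply/size0nil; rewrite size_map size_enum_ord.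
  by rewrite /= big1 // => b; have := leq_trans (ltn_ord b) (eq_leq l0).
pose z0 := (0%N, f (Ordinal l1)).
rewrite (block_coefE _ _ z0) size_map size_enum_ord big_mkord; apply: eq_bigr => b _.
rewrite coord_seq_parts (nth_map b) ?size_enum_ord // nth_ord_enum /=; congr (fun_of_matrix _ _ _).
rewrite /block_eval -[sumn (take b l)]/(block_start l b).
have -> : take (nth 0%N l b) (drop (block_start l b) (codom s)) =
   [seq s i | i <- take (nth 0%N l b) (drop (block_start l b) (enum 'I_(sumn l)))].
  by rewrite codomE -map_drop -map_take.
rewrite big_map.
have -> : iota (block_start l b) (nth 0%N l b) =
   map val (take (nth 0%N l b) (drop (block_start l b) (enum 'I_(sumn l)))).
  rewrite map_take map_drop val_enum_ord drop_iota take_iota add0n; congr iota.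
  have := congr1 sumn (cat_take_drop b l); rewrite sumn_cat (drop_nth 0%N) //= -/(block_start l b).
  by move=> <-; rewrite addKn; apply/esym/minn_idPl/leq_addr.
rewrite big_map; apply: eq_bigr => i _; congr A.
by rewrite /perm_nat valK.
Qed.
End STCoordinates.

(** * The generic anticommuting matrix *)

Lemma jw_prod_neq0 (K : fieldType) n : \prod_(i < n) jw K n i != 0.
Proof.
by have := jw_prod_iota_neq0 K n; rewrite -(big_mkord xpredT (jw K n)) /index_iota subn0.
Qed.

Section Generic.
Variables (K : fieldType) (d : nat).
Let N := #|{: 'I_d * 'I_d}|.

Definition generic_entry (q : 'I_d * 'I_d) : 'M[K]_((jw_dim N).+1) := jw K N (enum_rank q).

Definition generic_mx : 'M['M[K]_((jw_dim N).+1)]_d := \matrix_(i, j) generic_entry (i, j).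

Lemma generic_entry_anticomm p q :
  generic_entry p * generic_entry q = - (generic_entry q * generic_entry p).
Proof. exact: jw_anticomm. Qed.

Lemma generic_mx_anticomm i j k l :
  generic_mx i j * generic_mx k l = - (generic_mx k l * generic_mx i j).
Proof. by rewrite !mxE generic_entry_anticomm. Qed.

Lemma mx_delta_expand (R : pzRingType) (L : lalgType R) (X : 'M[L]_d) i j :
  X i j = \sum_(q : 'I_d * 'I_d) (delta_mx q.1 q.2 : 'M[R]_d) i j *: X q.1 q.2.
Proof.
rewrite (bigD1 (i, j)) //= big1 ?addr0 => [|[k l] /= ne]; first by rewrite mxE !eqxx scale1r.
rewrite mxE; case: eqP => [ik|]; case: eqP => [jl|] /=; rewrite ?scale0r //.
by rewrite ik jl eqxx in ne.
Qed.

Lemma prod_generic_nuniq (s : seq ('I_d * 'I_d)) :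
  \prod_(q <- s) generic_entry q != 0 -> uniq s.
Proof.
apply: contraNT => /(anticomm_prod_nuniq generic_entry_anticomm) -> // q; exact: jw_sqr.
Qed.

Lemma prod_generic_neq0 (s : seq ('I_d * 'I_d)) :
  perm_eq s (enum {: 'I_d * 'I_d}) -> \prod_(q <- s) generic_entry q != 0.
Proof.
move=> ps; have pe : perm_eq s (codom (@enum_val _ {: 'I_d * 'I_d})).
  apply: perm_trans ps _; apply: uniq_perm; rewrite ?enum_uniq //.
    by apply/injectiveP; apply: enum_val_inj.
  move=> q; rewrite mem_enum; apply/esym/codomP; exists (enum_rank q).
  by rewrite enum_rankK.
have [b ->] := perm_anticomm_prod generic_entry_anticomm pe.
rewrite big_prod_codom; under eq_bigr do rewrite /generic_entry enum_valK.
by rewrite mulr_sign; case: b; rewrite ?oppr_eq0 jw_prod_neq0.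
Qed.

Lemma generic_mxE i j :
  generic_mx i j = \sum_q (delta_mx q.1 q.2 : 'M[K]_d) i j *: generic_entry q.
Proof.
rewrite (mx_delta_expand (R := K)); apply: eq_bigr => -[k l] _; congr (_ *: _).
by rewrite mxE.
Qed.

Hypothesis chK : [pchar K] =i pred0.

Lemma pad_size (I : finType) (k : nat) (h : 'I_k -> I) : injective h ->
  size [seq q <- enum I | q \notin codom h] = (#|I| - k)%N.
Proof.
move=> h_inj; rewrite -[in RHS](card_ord k) -(card_codom h_inj) -[#|I|](cardC (mem (codom h))) addKn.
by rewrite cardE enumT; congr size; apply: eq_filter => q; rewrite !inE.
Qed.

Lemma pad_perm (I : finType) (k : nat) (h : 'I_k -> I) : injective h ->
  perm_eq (codom h ++ [seq q <- enum I | q \notin codom h]) (enum I).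
Proof.
move=> h_inj; apply: uniq_perm; rewrite ?enum_uniq //.
  rewrite cat_uniq filter_uniq ?enum_uniq // andbT; apply/andP; split.
    by have /injectiveP := h_inj.
  by apply/hasPn => q; rewrite mem_filter => /andP[].
by move=> q; rewrite mem_cat mem_filter mem_enum andbT orbN.
Qed.

Lemma entry_prod_cat (R : pzRingType) (X : 'M[R]_d) z1 z2 :
  entry_prod X (z1 ++ z2) = entry_prod X z1 * entry_prod X z2.
Proof. exact: big_cat. Qed.

Lemma uniq_codom_inj (k : nat) (Q : finType) (h : 'I_k -> Q) : uniq (codom h) -> injective h.
Proof. by move=> u; apply/injectiveP. Qed.

(** The generators missing from [h] are the entries at the padding parts 1. Multiplying by them
    kills every word except rearrangements of [h] and leaves the given coefficient times the product
    of all generators. *)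
Lemma generic_pad_neq0 (z : seq (nat * ('I_d * 'I_d))) (k := sumn (unzip1 z))
    (h : {ffun 'I_k -> 'I_d * 'I_d}) : injective h ->
  alt_coef (fun i => delta_mx (h i).1 (h i).2 : 'M[K]_d) z != 0 ->
  exists z', unzip1 z' = unzip1 z ++ nseq (N - k) 1%N /\ entry_prod generic_mx z' != 0.
Proof.
move=> h_inj nz; pose rest := [seq q <- enum {: 'I_d * 'I_d} | q \notin codom h].
exists (z ++ [seq (1%N, q) | q <- rest]); split.
  rewrite /unzip1 map_cat -map_comp; congr (_ ++ _).
  by rewrite -(pad_size h_inj) -/rest; elim: rest => //= q r ->.
rewrite entry_prod_cat.
have -> : entry_prod generic_mx [seq (1%N, q) | q <- rest] = \prod_(q <- rest) generic_entry q.
  by rewrite /entry_prod big_map; apply: eq_bigr => -[i j] _; rewrite expr1 mxE.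
rewrite (entry_prod_top generic_mxE generic_entry_anticomm h_inj).
  rewrite scaler_eq0 (negbTE nz) -big_prod_codom -big_cat.
  by apply: prod_generic_neq0; apply: pad_perm.
move=> h'; rewrite -big_prod_codom -big_cat => /prod_generic_nuniq.
rewrite cat_uniq => /and3P[/uniq_codom_inj h'_inj /hasPn hr _]; split=> // q qh'.
apply/negPn/negP => nq; have := hr q; rewrite mem_filter nq mem_enum => /(_ isT) /negP; exact.
Qed.

(** Attaching Grassmann generators to the matrices [A] gives a matrix X with nonzero entry product;
    re-expanding it in its own entries replaces [A] by elementary matrices. These entries
    anticommute and square to zero, so the surviving choice [h] of entries is injective, whence the
    bound on k. *)
Lemma alt_coef_neq0_pad (z : seq (nat * ('I_d * 'I_d))) (k := sumn (unzip1 z))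
    (A : 'I_k -> 'M[K]_d) : alt_coef A z != 0 ->
  (k <= N)%N /\
  exists z', unzip1 z' = unzip1 z ++ nseq (N - k) 1%N /\ entry_prod generic_mx z' != 0.
Proof.
move=> nz; pose e (p : 'I_k) := jw K k p.
pose X : 'M['M[K]_((jw_dim k).+1)]_d := \matrix_(i, j) \sum_p A p i j *: e p.
have XE i j : X i j = \sum_p A p i j *: e p by rewrite mxE.
have e_anti p q : e p * e q = - (e q * e p) by apply: jw_anticomm.
have X_anti p q : X p.1 p.2 * X q.1 q.2 = - (X q.1 q.2 * X p.1 p.2).
  rewrite !XE !mulr_suml; under eq_bigr do rewrite mulr_sumr.
  rewrite exchange_big -sumrN /=; apply: eq_bigr => i _; rewrite mulr_sumr -sumrN.
  apply: eq_bigr => j _; rewrite -scalerAl -scalerAr -[in RHS]scalerAl -[in RHS]scalerAr.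
  by rewrite e_anti !scalerN !scalerA mulrC.
have X_sqr p : X p.1 p.2 * X p.1 p.2 = 0.
  apply: (lmod_mulrn_eq0 chK (m := 1)).
  by rewrite mulr2n {1}X_anti addNr.
have Xz : entry_prod X z != 0.
  have := entry_prod_top XE e_anti (g := id) (r := 1) (fun _ _ => id); rewrite !mulr1 => ->.
    by rewrite scaler_eq0 (negbTE nz) jw_prod_neq0.
  move=> h; rewrite mulr1 -big_prod_codom => hnz; split; last by move=> q _; apply/codomP; exists q.
  apply: uniq_codom_inj; apply: contraNT hnz => /(anticomm_prod_nuniq e_anti) -> // p.
  exact: jw_sqr.
have /= := entry_prod_sym (mx_delta_expand (R := K) X) X_anti z; rewrite -/k.
have [h hnz|all0] := pickP (fun h : {ffun 'I_k -> 'I_d * 'I_d} =>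
    alt_coef (fun i => delta_mx (h i).1 (h i).2 : 'M[K]_d) z *: \prod_i X (h i).1 (h i).2 != 0).
  move=> _; have h_inj : injective h.
    apply: uniq_codom_inj; apply: contraNT hnz => /(anticomm_prod_nuniq X_anti X_sqr).
    by rewrite big_prod_codom => ->; rewrite scaler0.
  split; first by have := leq_card h h_inj; rewrite card_ord.
  apply: (generic_pad_neq0 h_inj); apply: contraNneq hnz => ->.
  by rewrite scale0r.
rewrite big1 => [|h _]; last by apply/eqP; have /negbFE := all0 h.
move/eqP; rewrite -(prednK (fact_gt0 k)) => /eqP /(lmod_mulrn_eq0 chK) Xz0.
by rewrite Xz0 eqxx in Xz.
Qed.

Lemma ST_neq0_pad (l : seq nat) (A : nat -> 'M[K]_d) f : ST_coord (l := l) A f != 0 ->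
  (sumn l <= N)%N /\
  exists z, unzip1 z = l ++ nseq (N - sumn l) 1%N /\ entry_prod generic_mx z != 0.
Proof.
rewrite ST_coord_alt; move: (coord_seq_parts f); set z := coord_seq f => zl nz.
have := @alt_coef_neq0_pad z (fun i => A i); rewrite zl; exact.
Qed.

(** A prefix of a nonzero product is nonzero, so the padding can be cut off; [entry_prod_sym] then
    finds elementary matrices with a nonzero coordinate. *)
Lemma pad_ST_neq0 (l : seq nat) r z : unzip1 z = l ++ nseq r 1%N -> entry_prod generic_mx z != 0 ->
  exists A f, ST_coord (F := K) (d := d) (l := l) A f != 0.
Proof.
move=> zE nz; pose z1 := take (size l) z.
have z1l : unzip1 z1 = l by rewrite /z1 /unzip1 map_take -/(unzip1 z) zE take_size_cat.
have z1nz : entry_prod generic_mx z1 != 0.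
  apply: contraNneq nz => z10; rewrite -(cat_take_drop (size l) z) entry_prod_cat -/z1 z10.
  by rewrite mul0r.
have [f fz] := coord_seq_surj z1l.
have := entry_prod_sym generic_mxE generic_entry_anticomm z1; rewrite z1l => Esym.
have [h hnz|all0] := pickP (fun h : {ffun 'I_(sumn l) -> 'I_d * 'I_d} =>
    alt_coef (fun i => delta_mx (h i).1 (h i).2 : 'M[K]_d) z1 != 0).
  exists (fun p => if insub p is Some i then delta_mx (h i).1 (h i).2 else 0), f.
  rewrite ST_coord_alt fz; apply: contra_neq hnz => <-.
  by apply: eq_alt_coef => i; rewrite valK.
move: Esym => /=; rewrite big1 => [|h _]; last by have /negbFE/eqP -> := all0 h; rewrite scale0r.
move/eqP; rewrite -(prednK (fact_gt0 _)) => /eqP /(lmod_mulrn_eq0 chK) z10.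
by rewrite z10 eqxx in z1nz.
Qed.
End Generic.

(** * Invariance under gl_d *)

Section Commutator.
Variable R : pzRingType.
Implicit Types x y z : R.

Definition commutator x y := x * y - y * x.

Lemma commutator_suml (I : Type) (s : seq I) (u : I -> R) y :
  commutator (\sum_(i <- s) u i) y = \sum_(i <- s) commutator (u i) y.
Proof. by rewrite /commutator mulr_suml mulr_sumr -sumrB. Qed.

Lemma commutator_sumr (I : Type) (s : seq I) (u : I -> R) x :
  commutator x (\sum_(i <- s) u i) = \sum_(i <- s) commutator x (u i).
Proof. by rewrite /commutator mulr_suml mulr_sumr -sumrB. Qed.

Lemma commutatorBl x y z : commutator (x - y) z = commutator x z - commutator y z.
Proof.
rewrite /commutator mulrBl mulrBr !opprB addrACA [RHS]addrACA; congr (_ + _).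
exact: addrC.
Qed.

Lemma commutatorM x y z : commutator x (y * z) = commutator x y * z + y * commutator x z.
Proof. by rewrite /commutator mulrBl mulrBr !mulrA addrA subrK. Qed.

Lemma prod_mem_eq0 (I : eqType) (s : seq I) (b : I) (u : I -> R) :
  b \in s -> u b = 0 -> \prod_(c <- s) u c = 0.
Proof. by case/splitPr=> s1 s2 ub; rewrite big_cat big_cons /= ub mul0r mulr0. Qed.

Lemma commutator_prod (I : eqType) (s : seq I) x (u : I -> R) : uniq s ->
  commutator x (\prod_(c <- s) u c) =
    \sum_(b <- s) \prod_(c <- s) (if c == b then commutator x (u b) else u c).
Proof.
elim: s => [|a s IHs] /=; first by rewrite !big_nil /commutator mulr1 mul1r subrr.
case/andP=> nas us; rewrite !big_cons commutatorM {}IHs // eqxx; congr (_ * _ + _).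
  rewrite [LHS]big_seq [RHS]big_seq; apply: eq_bigr => c cs; case: eqP => // ca.
  by rewrite -ca cs in nas.
rewrite mulr_sumr [LHS]big_seq [RHS]big_seq; apply: eq_bigr => b bs; rewrite big_cons.
by case: eqP => // ab; rewrite ab bs in nas.
Qed.
End Commutator.

Section GlAction.
Variables (K : fieldType) (d : nat).
Let N := #|{: 'I_d * 'I_d}|.
Local Notation x := (@generic_entry K d).
Local Notation y q := (x q)^T.
Local Notation X := (generic_mx K d).

(* The infinitesimal action of the elementary matrix E_ab by conjugation on the
   generic matrix, as an inner derivation of the algebra of all operators. *)
Definition gl_op (a b : 'I_d) : 'M[K]_((jw_dim N).+1) :=
  \sum_j x (b, j) * y (a, j) - \sum_i x (i, a) * y (i, b).

Lemma commutator_elementary q p r : commutator (x q * y p) (x r) = if p == r then x q else 0.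
Proof.
have car : x r * y p + y p * x r = (p == r)%:R%:M.
  by rewrite jw_trmx_anticomm // -(inj_eq enum_rank_inj) eq_sym.
rewrite /commutator -mulrA [x r * _]mulrA (generic_entry_anticomm K r q) mulNr opprK -mulrA -mulrDr addrC car.
by case: eqP => _; rewrite ?raddf0 ?mulr0 ?mulr1.
Qed.

(** By the Leibniz rule only the factor x_p changes, into x_q. For p different from q the generator
    x_q then occurs twice. *)
Lemma commutator_elementary_prod q p s : perm_eq s (enum {: 'I_d * 'I_d}) ->
  commutator (x q * y p) (\prod_(r <- s) x r) = if p == q then \prod_(r <- s) x r else 0.
Proof.
move=> ps; have us : uniq s by rewrite (perm_uniq ps) enum_uniq.
have ins r : r \in s by rewrite (perm_mem ps) mem_enum.
rewrite commutator_prod // (bigD1_seq p) //= [X in _ + X]big1 ?addr0 => [|b bp]; last first.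
  apply: (prod_mem_eq0 (ins b)); rewrite eqxx commutator_elementary.
  by rewrite eq_sym (negbTE bp).
case: (eqVneq p q) => [->|pq].
  by apply: eq_bigr => r _; rewrite commutator_elementary eqxx; case: eqP => [->|].
have -> : \prod_(c <- s) (if c == p then commutator (x q * y p) (x p) else x c) =
    \prod_(c <- [seq if c == p then q else c | c <- s]) x c.
  rewrite big_map; apply: eq_bigr => c _; rewrite commutator_elementary eqxx.
  by case: eqP.
(* The substituted word has N letters, all different from p, so it cannot be duplicate-free. *)
apply/eqP; apply: contraTT pq => /prod_generic_nuniq /card_uniqP us'.
have : (#|[seq if c == p then q else c | c <- s]| <= #|predC1 p|)%N -> (N <= N.-1)%N.
  by rewrite us' size_map (perm_size ps) -cardE cardC1.
have N0 : (0 < N)%N by apply/card_gt0P; exists p.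
rewrite -[X in _ -> (X <= _)%N](prednK N0) ltnn negbK => H; apply/eqP/eqP; apply: contraTT isT => pq.
suff : false by []. apply: H; apply/subset_leq_card/subsetP => c /mapP[c' _ ->]; rewrite !inE.
by case: (eqVneq c' p) => //; rewrite eq_sym.
Qed.

(** On the product of all generators a derivation acts by its trace, and left and right
    multiplication by E_ab have equal traces. *)
Lemma gl_op_prod a b s : perm_eq s (enum {: 'I_d * 'I_d}) ->
  commutator (gl_op a b) (\prod_(r <- s) x r) = 0.
Proof.
move=> ps; rewrite commutatorBl !commutator_suml -sumrB big1 // => i _.
by rewrite !commutator_elementary_prod // !xpair_eqE eqxx andbT [b == a]eq_sym subrr.
Qed.

Lemma gl_op_entry a b i j :
  commutator (gl_op a b) (X i j) = (i == a)%:R * X b j - (j == b)%:R * X i a.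
Proof.
rewrite commutatorBl !commutator_suml !mxE; congr (_ - _).
  rewrite (bigD1 j) //= big1 ?addr0 => [|l lj]; rewrite commutator_elementary xpair_eqE.
    by rewrite eqxx andbT eq_sym; case: eqP; rewrite ?mul1r ?mul0r.
  by rewrite (negbTE lj) andbF.
rewrite (bigD1 i) //= big1 ?addr0 => [|l lj]; rewrite commutator_elementary xpair_eqE.
  by rewrite eqxx eq_sym; case: eqP; rewrite ?mul1r ?mul0r.
by rewrite (negbTE lj).
Qed.

(** This is entry (i, j) of the commutator of E_ab with X^m. In the induction, the two middle terms
    X E_ab X^m, computed in [E2] and [E3], cancel. *)
Lemma gl_op_mxexp a b m i j :
  commutator (gl_op a b) ((X ^+ m) i j) =
    (i == a)%:R * (X ^+ m) b j - (j == b)%:R * (X ^+ m) i a.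
Proof.
have deltaE k l : (1 : 'M['M[K]_((jw_dim N).+1)]_d) k l = (k == l)%:R by rewrite mxE.
elim: m i j => [|m IHm] i j.
  rewrite expr0 !deltaE -natrM -natrM [b == j]eq_sym mulnC subrr.
  by rewrite /commutator; case: (i == j); rewrite ?mulr1 ?mul1r ?mulr0 ?mul0r subrr.
rewrite exprS ![(X * X ^+ m) _ _]mxE commutator_sumr.
under eq_bigr do rewrite commutatorM gl_op_entry IHm mulrBl mulrBr.
rewrite big_split /= !sumrB.
have sel (k : 'I_d) (u : 'I_d -> 'M[K]_((jw_dim N).+1)) : \sum_l (l == k)%:R * u l = u k.
  rewrite (bigD1 k) //= eqxx mul1r big1 ?addr0 // => l /negbTE ->; exact: mul0r.
have E2 : \sum_l (l == b)%:R * X i a * (X ^+ m) l j = X i a * (X ^+ m) b j.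
  rewrite -(sel b (fun l => X i a * (X ^+ m) l j)).
  by apply: eq_bigr => l _; rewrite mulrA.
have E3 : \sum_l X i l * ((l == a)%:R * (X ^+ m) b j) = X i a * (X ^+ m) b j.
  rewrite -(sel a (fun l => X i l * (X ^+ m) b j)); apply: eq_bigr => l _.
  by case: eqP => _; rewrite ?mul1r ?mul0r ?mulr0.
rewrite E2 E3 addrA subrK; congr (_ - _).
  by rewrite mulr_sumr; apply: eq_bigr => l _; rewrite mulrA.
rewrite mulr_sumr; apply: eq_bigr => l _.
by case: eqP => _; rewrite ?mul1r ?mul0r ?mulr0.
Qed.

Section Invariance.
Variables (n : nat) (mu : 'I_n -> nat).
Local Notation index := {ffun 'I_n -> 'I_d}.

Definition set_at (i : index) (p : 'I_n) (b : 'I_d) : index :=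
  [ffun r => if r == p then b else i r].

Definition generic_tensor (i j : index) : 'M[K]_((jw_dim N).+1) :=
  \prod_r (X ^+ mu r) (i r) (j r).

Lemma gl_op_generic_tensor a b i j :
  commutator (gl_op a b) (generic_tensor i j) =
    \sum_p ((i p == a)%:R * generic_tensor (set_at i p b) j
           - (j p == b)%:R * generic_tensor i (set_at j p a)).
Proof.
rewrite commutator_prod ?index_enum_uniq //; apply: eq_bigr => p _.
rewrite gl_op_mxexp.
(* The ordered product is linear in its factor at position p, and the coefficients, being 0 or 1,
   can be moved to the front. *)
have split_prod (u v : 'M[K]_((jw_dim N).+1)) (e f : bool) :
    \prod_c (if c == p then e%:R * u - f%:R * v else (X ^+ mu c) (i c) (j c)) =
    e%:R * \prod_c (if c == p then u else (X ^+ mu c) (i c) (j c)) -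
    f%:R * \prod_c (if c == p then v else (X ^+ mu c) (i c) (j c)).
  have := index_enum_uniq 'I_n; have := mem_index_enum p.
  case/splitPr => s1 s2; rewrite cat_uniq /= => /and3P[_ /norP[ps1 _] /andP[ps2 _]].
  have off (s : seq 'I_n) (t : 'M[K]_((jw_dim N).+1)) : p \notin s ->
      \prod_(c <- s) (if c == p then t else (X ^+ mu c) (i c) (j c)) =
      \prod_(c <- s) (X ^+ mu c) (i c) (j c).
    move=> ps; rewrite big_seq [RHS]big_seq; apply: eq_bigr => c cs.
    by case: eqP => // cp; rewrite -cp cs in ps.
  rewrite !big_cat !big_cons /= eqxx !off // mulrBl mulrBr.
  by congr (_ - _); [case: e|case: f]; rewrite ?mul1r // !mul0r mulr0.
rewrite split_prod; congr (_ * _ - _ * _); apply: eq_bigr => c _; rewrite ffunE.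
  by case: eqP => [->|].
by case: eqP => [->|].
Qed.
End Invariance.
End GlAction.

(** * Invariant tensors with vanishing contractions *)

(** Exchanging b with the value of g at p is an involution on the pairs (g, b), and it removes the
    substitution. *)
Lemma sum_set_at (V : nmodType) (n d : nat) (F : {ffun 'I_n -> 'I_d} -> V) (p : 'I_n) :
  \sum_g \sum_b F (set_at g p b) = (\sum_g F g) *+ d.
Proof.
pose phi (u : {ffun 'I_n -> 'I_d} * 'I_d) := (set_at u.1 p u.2, u.1 p).
have phiK : involutive phi.
  move=> [g b]; rewrite /phi /= !ffunE eqxx; congr pair; apply/ffunP => r.
  by rewrite !ffunE; case: eqP => [->|].
rewrite pair_bigA (reindex_inj (inv_inj phiK)) /=.
transitivity (\sum_(u : {ffun 'I_n -> 'I_d} * 'I_d) F u.1).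
  by apply: eq_bigr => u _; rewrite -[set_at _ _ _]/(phi (phi u)).1 phiK.
rewrite -(pair_bigA _ (fun g _ => F g)) /= -sumrMnl; apply: eq_bigr => g _.
by rewrite sumr_const card_ord.
Qed.

Section InvariantTensor.
Variables (R : realDomainType) (n d : nat).
Local Notation index := {ffun 'I_n -> 'I_d}.
Variable T : index -> index -> R.
Hypothesis T_inv : forall (a b : 'I_d) (i j : index),
  \sum_p (i p == a)%:R * T (set_at i p b) j = \sum_p (j p == b)%:R * T i (set_at j p a).

Definition fill (S : {set 'I_n}) (g i : index) : index := [ffun r => if r \in S then g r else i r].

(* [partial_trace s S] contracts the upper positions r of S with the lower positions s^-1 r. *)
Definition partial_trace (s : 'S_n) (S : {set 'I_n}) (i j : index) : R :=
  \sum_g T (fill S g i) [ffun r => if s r \in S then g (s r) else j r].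

(** Summing the invariance of [T] over g gives one term per position. Terms at a contracted upper
    position and at its lower partner cancel, which leaves the free positions. *)
Lemma partial_trace_inv (s : 'S_n) (S : {set 'I_n}) (a b : 'I_d) (i j : index) :
  \sum_(p | p \notin S) (i p == a)%:R * partial_trace s S (set_at i p b) j =
  \sum_(q | s q \notin S) (j q == b)%:R * partial_trace s S i (set_at j q a).
Proof.
pose lo (g : index) : index := [ffun r => if s r \in S then g (s r) else j r].
have E : \sum_p \sum_g (fill S g i p == a)%:R * T (set_at (fill S g i) p b) (lo g) =
    \sum_q \sum_g (lo g q == b)%:R * T (fill S g i) (set_at (lo g) q a).
  rewrite exchange_big [RHS]exchange_big; apply: eq_bigr => g _; exact: T_inv.
rewrite (bigID (fun p => p \in S)) [RHS](bigID (fun q => s q \in S)) /= in E.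
have Ein : \sum_(p | p \in S) \sum_g (fill S g i p == a)%:R * T (set_at (fill S g i) p b) (lo g) =
    \sum_(q | s q \in S) \sum_g (lo g q == b)%:R * T (fill S g i) (set_at (lo g) q a).
  rewrite (reindex_inj (@perm_inj _ s)) /=; apply: eq_bigr => q sqS.
  (* Swapping a and b at the contracted position matches the two sides: both then have upper value b
     and lower value a there. *)
  pose phi (g : index) := set_at g (s q) (tperm a b (g (s q))).
  have phiK : involutive phi.
    move=> g; apply/ffunP => r; rewrite !ffunE eqxx tpermK.
    by case: eqP => [->|].
  rewrite [RHS](reindex_inj (inv_inj phiK)); apply: eq_bigr => g _.
  have -> : (lo (phi g) q == b) = (fill S g i (s q) == a).
    by rewrite !ffunE sqS eqxx (can2_eq (tpermK a b) (tpermK a b)) tpermR.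
  rewrite !ffunE sqS; case: eqP => [gqa|_]; last by rewrite !mul0r.
  congr (_ * T _ _); apply/ffunP => r; rewrite !ffunE.
    by case: eqP => [->|]; rewrite ?sqS ?gqa ?tpermL.
  have [->|nrq] := eqVneq r q; first by rewrite sqS.
  by case: ifP => // _; rewrite (inj_eq perm_inj) (negbTE nrq).
move: E; rewrite Ein => /addrI E.
transitivity (\sum_(p | p \notin S) \sum_g (fill S g i p == a)%:R * T (set_at (fill S g i) p b) (lo g)).
  apply: eq_bigr => p pS; rewrite mulr_sumr; apply: eq_bigr => g _.
  rewrite ffunE (negbTE pS); congr (_ * T _ _); apply/ffunP => r; rewrite !ffunE.
  by case: eqP => [->|]; rewrite ?(negbTE pS).
rewrite E; apply: eq_bigr => q qS; rewrite mulr_sumr; apply: eq_bigr => g _.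
rewrite ffunE (negbTE qS); congr (_ * T _ _); apply/ffunP => r; rewrite !ffunE.
by case: eqP => [->|]; rewrite ?(negbTE qS).
Qed.

(** The permutation is changed so that q goes to p. The factor d arises because [partial_trace] also
    sums over the values of g outside [S], on which its summand does not depend. *)
Lemma partial_trace_contract (s : 'S_n) (S : {set 'I_n}) (p q : 'I_n) (i j : index) :
  p \notin S -> s q \notin S ->
  \sum_b partial_trace s S (set_at i p b) (set_at j q b) =
    partial_trace (s * tperm (s q) p)%g (p |: S) i j *+ d.
Proof.
move=> pS qS; rewrite /partial_trace -(sum_set_at _ p) exchange_big; apply: eq_bigr => g _.
apply: eq_bigr => b _; congr T; apply/ffunP => r; rewrite !ffunE !inE.
  by case: (eqVneq r p) => [->|] //=; rewrite ?(negbTE pS).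
rewrite permM; have [->|nrq] := eqVneq r q; first by rewrite tpermL eqxx (negbTE qS).
have nsr : s q != s r by rewrite (inj_eq perm_inj) eq_sym.
have [srp|nrp] := eqVneq (s r) p; last by rewrite tpermD ?(negbTE nrp) // eq_sym.
by rewrite srp tpermR (negbTE pS) (negbTE qS) -srp (negbTE nsr).
Qed.

(** With the other indices fixed, the sum over the two values i p and j q factors into two
    contractions of [U], each of them zero. *)
Lemma sum_sqr_zero (p q : 'I_n) (U : index -> index -> R) :
  (forall (i j : index), \sum_b U (set_at i p b) (set_at j q b) = 0) ->
  \sum_(i : index) \sum_(j : index) U (set_at i p (j q)) j * U i (set_at j q (i p)) = 0.
Proof.
move=> U0; have [d0|d0] := posnP d.
  by apply: big1 => i _; have := leq_trans (ltn_ord (i p)) (eq_leq d0).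
pose G (i j : index) := U (set_at i p (j q)) j * U i (set_at j q (i p)).
suff : (\sum_(i : index) \sum_(j : index) G i j) *+ d *+ d = 0.
  by rewrite -mulrnA => /eqP; rewrite mulrn_eq0 muln_eq0 -leqn0 leqNgt d0 /= => /eqP.
rewrite -(sum_set_at (fun i => \sum_j G i j) p) -sumrMnl big1 // => i _.
rewrite -sumrMnl; under eq_bigr do rewrite -(sum_set_at _ q).
rewrite exchange_big big1 // => j _ /=.
transitivity (\sum_b \sum_c U (set_at i p c) (set_at j q c) * U (set_at i p b) (set_at j q b)).
  apply: eq_bigr => b _; apply: eq_bigr => c _; rewrite /G !ffunE !eqxx.
  by congr (U _ _ * U _ _); apply/ffunP => r; rewrite !ffunE; case: eqP.
by rewrite big1 // => b _; rewrite -mulr_suml U0 mul0r.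
Qed.

(* V is the translate of the partial trace by E_ab, written in two ways by invariance; the sum of
   V^2 is the product of the two forms, which only involves further contractions. *)
Lemma partial_trace_step (s : 'S_n) (S : {set 'I_n}) : S != setT ->
  (forall (t : 'S_n) p, p \notin S -> forall i j, partial_trace t (p |: S) i j = 0) ->
  forall i j, partial_trace s S i j = 0.
Proof.
move=> SnT IH; pose U := partial_trace s S.
pose V (a b : 'I_d) (i j : index) := \sum_(p | p \notin S) (i p == a)%:R * U (set_at i p b) j.
have Vsqr : \sum_(i : index) \sum_(j : index) \sum_a \sum_b V a b i j ^+ 2 = 0.
  transitivity (\sum_(p | p \notin S) \sum_(q | s q \notin S) \sum_(i : index) \sum_(j : index)
      U (set_at i p (j q)) j * U i (set_at j q (i p))).
    have sel (a : 'I_d) (H : 'I_d -> R) : \sum_b (a == b)%:R * H b = H a.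
      rewrite (bigD1 a) //= eqxx mul1r big1 ?addr0 // => b; rewrite eq_sym => /negbTE ->.
      exact: mul0r.
    (* One factor V is rewritten through the lower indices; the Kronecker deltas then force a = i p
       and b = j q. *)
    have ptwise i j : \sum_a \sum_b V a b i j ^+ 2 =
        \sum_(p | p \notin S) \sum_(q | s q \notin S) U (set_at i p (j q)) j * U i (set_at j q (i p)).
      pose W (a b : 'I_d) := \sum_(q | s q \notin S) (j q == b)%:R * U i (set_at j q a).
      transitivity (\sum_a \sum_(p | p \notin S) (i p == a)%:R * \sum_b U (set_at i p b) j * W a b).
        apply: eq_bigr => a _; under [RHS]eq_bigr do rewrite mulr_sumr.
        rewrite [RHS]exchange_big; apply: eq_bigr => b _; rewrite expr2 {2}/V partial_trace_inv.
        by rewrite mulr_suml; apply: eq_bigr => p _; rewrite mulrA.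
      rewrite exchange_big; apply: eq_bigr => p _ /=; rewrite (sel (i p)) /W.
      under eq_bigr do rewrite mulr_sumr; rewrite exchange_big; apply: eq_bigr => q _ /=.
      under eq_bigr do rewrite mulrCA; exact: (sel (j q)).
    under eq_bigr do under eq_bigr do rewrite ptwise.
    under eq_bigr do rewrite exchange_big /=.
    rewrite exchange_big; apply: eq_bigr => p _ /=.
    under eq_bigr do rewrite exchange_big /=.
    by rewrite exchange_big.
  rewrite big1 // => p pS; rewrite big1 // => q qS; apply: sum_sqr_zero => i j.
  by rewrite partial_trace_contract // IH // mul0rn.
have V0 a b i j : V a b i j = 0.
  apply/eqP; rewrite -sqrf_eq0; move: Vsqr => /eqP.
  rewrite psumr_eq0 => [/allP/(_ i (mem_index_enum _)) /=|i' _]; last first.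
    by do 3!(apply: sumr_ge0 => ? _); apply: sqr_ge0.
  rewrite psumr_eq0 => [/allP/(_ j (mem_index_enum _)) /=|i' _]; last first.
    by do 2!(apply: sumr_ge0 => ? _); apply: sqr_ge0.
  rewrite psumr_eq0 => [/allP/(_ a (mem_index_enum _)) /=|i' _]; last first.
    by apply: sumr_ge0 => ? _; apply: sqr_ge0.
  by rewrite psumr_eq0 => [/allP/(_ b (mem_index_enum _))|i' _]; last apply: sqr_ge0.
move=> i j; have [p pS] : exists p, p \notin S.
  by move: SnT; rewrite -subTset => /subsetPn[p _ pS]; exists p.
(* For a = b = i p no index changes, so V is [U i j] times the number of free positions r with i r =
   i p; p itself is one of them. *)
have := V0 (i p) (i p) i j; rewrite /V.
rewrite (eq_bigr (fun r => U i j *+ (i r == i p))) => [|r _]; last first.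
  rewrite mulr_natl; case: eqP => [ir|] //=; congr (U _ _ *+ _); apply/ffunP => t.
  by rewrite ffunE; case: eqP => [->|].
rewrite sumrMnr => /eqP; rewrite mulrn_eq0 => /orP[|/eqP //].
by rewrite (bigD1 p) //= eqxx.
Qed.

(** Induction on the number of uncontracted positions: with none left the hypothesis applies, and
    for empty [S] the partial trace is a positive multiple of [T i j]. *)
Lemma invariant_tensor_eq0 :
  (forall s : 'S_n, \sum_g T g [ffun r => g (s r)] = 0) -> forall i j, T i j = 0.
Proof.
move=> T0 i j.
have U0 m : forall s S, #|~: S| = m -> forall i j, partial_trace s S i j = 0.
  elim: m => [|m IHm] s S cS.
    move: cS => /eqP; rewrite cards_eq0 => /eqP/(congr1 (@setC _)); rewrite setCK setC0 => -> k l.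
    rewrite -[RHS](T0 s); apply: eq_bigr => g _.
    by congr T; apply/ffunP => r; rewrite !ffunE inE.
  apply: partial_trace_step => [|t p pS].
    by apply: contra_eq_neq cS => ->; rewrite setCT cards0.
  apply: IHm; apply/eqP; rewrite -eqSS -cS.
  have -> : ~: (p |: S) = (~: S) :\ p by apply/setP => r; rewrite !inE negb_or.
  by rewrite [#|~: S|](cardsD1 p) inE pS.
have := U0 _ 1%g set0 erefl i j; rewrite /partial_trace.
rewrite (eq_bigr (fun=> T i j)) => [|g _]; last first.
  by congr T; apply/ffunP => r; rewrite !ffunE inE.
rewrite sumr_const => /eqP; rewrite mulrn_eq0 => /orP[|/eqP //].
by rewrite -leqn0 leqNgt => /negP[]; apply/card_gt0P; exists i.
Qed.
End InvariantTensor.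

(** * Contractions along the cycles of a permutation *)

Section SumAlong.
Variables (n d : nat).
Local Notation index := {ffun 'I_n -> 'I_d}.

(** Contracting one position at a time lets the cycles of a permutation be summed one after
    another. *)
Fixpoint sum_along (V : nmodType) (t : seq 'I_n) (F : index -> V) (g : index) : V :=
  if t is p :: t' then \sum_b sum_along t' F (set_at g p b) else F g.

Definition agree_off (t : seq 'I_n) (g h : index) := forall r, r \notin t -> h r = g r.

Lemma eq_sum_along (V : nmodType) t (F G : index -> V) g :
  (forall h, agree_off t g h -> F h = G h) -> sum_along t F g = sum_along t G g.
Proof.
elim: t g => [|p t IHt] g FG /=; first exact: FG.
apply: eq_bigr => b _; apply: IHt => h hg; apply: FG => r; rewrite inE negb_or => /andP[rp rt].
by rewrite hg // ffunE (negbTE rp).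
Qed.

Lemma sum_along_cat (V : nmodType) t u (F : index -> V) g :
  sum_along (t ++ u) F g = sum_along t (sum_along u F) g.
Proof. by elim: t g => [|p t IHt] g //=; apply: eq_bigr => b _; rewrite IHt. Qed.

Lemma sum_along_mull (R : pzRingType) t (x : R) (F : index -> R) g :
  sum_along t (fun h => x * F h) g = x * sum_along t F g.
Proof. by elim: t g => [|p t IHt] g //=; rewrite mulr_sumr; apply: eq_bigr => b _; rewrite IHt. Qed.

Lemma sum_along_mulr (R : pzRingType) t (x : R) (F : index -> R) g :
  sum_along t (fun h => F h * x) g = sum_along t F g * x.
Proof. by elim: t g => [|p t IHt] g //=; rewrite mulr_suml; apply: eq_bigr => b _; rewrite IHt. Qed.

Lemma sum_sum_along (V : nmodType) t (F : index -> V) :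
  \sum_g sum_along t F g = (\sum_g F g) *+ d ^ size t.
Proof.
elim: t => [|p t IHt] /=; first by rewrite mulr1n.
by rewrite (sum_set_at (sum_along t F) p) IHt -mulrnA mulnC -expnS.
Qed.

Variables (R : pzRingType) (M : 'I_n -> 'M[R]_d) (s : 'S_n).

Fixpoint chain (p : 'I_n) (t : seq 'I_n) (y : 'I_d) (g : index) : R :=
  if t is q :: t' then M p (g p) (g q) * chain q t' y g else M p (g p) y.

Lemma sum_along_chain p t y g : uniq (p :: t) ->
  sum_along t (chain p t y) g = (\prod_(q <- p :: t) M q) (g p) y.
Proof.
elim: t p g => [|q t IHt] p g; first by rewrite big_seq1.
rewrite big_cons mxE => /andP[pqt uqt] /=; apply: eq_bigr => b _.
have /norP[pq pt] : ~~ ((p == q) || (p \in t)) by rewrite -in_cons.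
have /andP[qt _] := uqt.
rewrite (@eq_sum_along _ _ _ (fun h => M p (g p) b * chain q t y h)) => [|h hg].
  by rewrite sum_along_mull IHt // ffunE eqxx.
by rewrite !hg // !ffunE (negbTE pq) eqxx.
Qed.

Lemma prod_fpath_chain p t (g : index) : fpath s p t ->
  \prod_(r <- p :: t) M r (g r) (g (s r)) = chain p t (g (s (last p t))) g.
Proof.
elim: t p => [|q t IHt] p /=; first by rewrite big_seq1.
by case/andP=> /eqP spq pt; rewrite big_cons IHt // spq.
Qed.

Lemma sum_along_cycle c g : fcycle s c -> uniq c -> c != [::] ->
  sum_along c (fun h => \prod_(r <- c) M r (h r) (h (s r))) g = \tr (\prod_(r <- c) M r).
Proof.
case: c => [//|p t]; rewrite [fcycle _ _]/= rcons_path => /andP[pt /eqP slast] u _.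
rewrite /mxtrace [LHS]/=; apply: eq_bigr => b _; have /andP[npt _] := u.
rewrite (@eq_sum_along _ _ _ (chain p t b)) => [|h hg].
  by rewrite sum_along_chain // ffunE eqxx.
by rewrite prod_fpath_chain // slast hg // ffunE eqxx.
Qed.

Lemma sum_along_cycles (cs : seq (seq 'I_n)) g : uniq (flatten cs) ->
  (forall c, c \in cs -> fcycle s c && (c != [::])) ->
  sum_along (flatten cs) (fun h => \prod_(r <- flatten cs) M r (h r) (h (s r))) g =
    \prod_(c <- cs) \tr (\prod_(r <- c) M r).
Proof.
elim: cs g => [|c cs IHcs] g /=; first by rewrite !big_nil.
rewrite cat_uniq => /and3P[uc /hasPn dis ucs] hcs; rewrite sum_along_cat big_cons.
have /andP[cc c0] : fcycle s c && (c != [::]) by apply: hcs; rewrite mem_head.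
rewrite (@eq_sum_along _ _ _ (fun h => (\prod_(r <- c) M r (h r) (h (s r))) *
    \prod_(c <- cs) \tr (\prod_(r <- c) M r))) => [|h _].
  by rewrite sum_along_mulr sum_along_cycle.
rewrite -(IHcs h) // => [|c' c'cs]; last by apply: hcs; rewrite inE c'cs orbT.
rewrite -sum_along_mull; apply: eq_sum_along => k kh; rewrite big_cat /=; congr (_ * _).
have off r : r \in c -> r \notin flatten cs by apply: contraL; apply: dis.
rewrite big_seq [RHS]big_seq; apply: eq_bigr => r rc; rewrite !kh ?off //.
by have /eqP -> := next_cycle cc rc; rewrite mem_next.
Qed.
End SumAlong.

Section Orbits.
Variables (n : nat) (s : 'S_n).

Definition orbit_cycle (C : {set 'I_n}) : seq 'I_n :=
  if [pick x in C] is Some x then traject s x #|C| else [::].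

Lemma orbit_cycleP (C : {set 'I_n}) : C \in porbits s ->
  [/\ fcycle s (orbit_cycle C), orbit_cycle C != [::], uniq (orbit_cycle C) & orbit_cycle C =i C].
Proof.
case/imsetP => x _ ->; rewrite /orbit_cycle; case: pickP => [y|/(_ x)]; last by rewrite porbit_id.
rewrite -eq_porbit_mem eq_sym => /eqP ->.
split; last 2 first.
- exact: uniq_traject_porbit.
- by move=> r; rewrite -porbit_traject.
- have : (0 < #|porbit s y|)%N by apply/card_gt0P; exists y; apply: porbit_id.
  have := iter_porbit s y; case: #|_| => //= m sm _.
  by rewrite rcons_path fpath_traject last_traject /= sm.
- have : (0 < #|porbit s y|)%N by apply/card_gt0P; exists y; apply: porbit_id.
  by case: #|_|.
Qed.

Lemma perm_orbit_cycles :
  perm_eq (flatten [seq orbit_cycle C | C <- enum (porbits s)]) (enum 'I_n).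
Proof.
apply/allP => x _ /=; rewrite (count_uniq_mem _ (enum_uniq _)) mem_enum.
rewrite count_flatten -map_comp sumnE big_map.
rewrite (bigD1_seq (porbit s x)) ?enum_uniq ?mem_enum ?imset_f //= big_seq_cond big1 => [|C].
  have [|_ _ u m] := @orbit_cycleP (porbit s x); first by apply/imsetP; exists x.
  by rewrite addn0 (count_uniq_mem _ u) m porbit_id.
rewrite mem_enum => /andP[CP nC]; have [_ _ u m] := orbit_cycleP CP.
rewrite (count_uniq_mem _ u) m; case: (boolP (x \in C)) => // xC.
case/imsetP: CP xC nC => y _ ->; rewrite -eq_porbit_mem => /eqP ->.
by rewrite eqxx.
Qed.
End Orbits.

(** Reordering the factors cycle by cycle costs a sign depending only on the degrees [mu], hence
    common to all g; each cycle then sums to one trace. *)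
Lemma trace_contraction (K : fieldType) (L : algType K) (n d : nat) (X : 'M[L]_d)
    (mu : 'I_n -> nat) (s : 'S_n) :
  [pchar K] =i pred0 -> (0 < d)%N ->
  (forall i j k l, X i j * X k l = - (X k l * X i j)) ->
  exists b : bool,
    \sum_(g : {ffun 'I_n -> 'I_d}) \prod_r (X ^+ mu r) (g r) (g (s r)) =
    (-1) ^+ b * \prod_(C <- enum (porbits s)) \tr (X ^+ (\sum_(r in C) mu r)).
Proof.
move=> chK d0 antiX; set cs := [seq orbit_cycle s C | C <- enum (porbits s)].
have pcs := perm_orbit_cycles s; rewrite -/cs in pcs.
have pindex : perm_eq (index_enum 'I_n) (flatten cs).
  by rewrite [index_enum _]unlock -enumT perm_sym.
have [b hb] := perm_signed_prod mu pindex; exists b.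
have signs (g : {ffun 'I_n -> 'I_d}) : \prod_r (X ^+ mu r) (g r) (g (s r)) =
    (-1) ^+ b * \prod_(r <- flatten cs) (X ^+ mu r) (g r) (g (s r)).
  by apply: hb => i j; apply: mxexp_signed_comm.
rewrite (eq_bigr _ (fun g _ => signs g)) -mulr_sumr; congr (_ * _).
have ucs : uniq (flatten cs) by rewrite (perm_uniq pcs) enum_uniq.
have scs : size (flatten cs) = n by rewrite (perm_size pcs) size_enum_ord.
pose F (g : {ffun 'I_n -> 'I_d}) := \prod_(r <- flatten cs) (X ^+ mu r) (g r) (g (s r)).
have alongE g : sum_along (flatten cs) F g =
    \prod_(C <- enum (porbits s)) \tr (X ^+ (\sum_(r in C) mu r)).
  rewrite (sum_along_cycles (fun r => X ^+ mu r)) // => [|c /mapP[C CP ->]].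
    rewrite big_map big_seq [RHS]big_seq; apply: eq_bigr => C; rewrite mem_enum => /orbit_cycleP[_ _ u m].
    congr (\tr _); transitivity (X ^+ (\sum_(r <- orbit_cycle s C) mu r)).
      by elim: (orbit_cycle s C) => [|r t IHt]; rewrite ?big_nil // !big_cons IHt exprD.
    by rewrite big_uniq //; congr (_ ^+ _); apply: eq_bigl.
  by move: CP; rewrite mem_enum => /orbit_cycleP[-> ->].
(* The iterated sum does not depend on its starting index, so both sides carry a factor d^n,
   cancelled in characteristic 0. *)
have := sum_sum_along (flatten cs) F; rewrite (eq_bigr _ (fun g _ => alongE g)).
rewrite sumr_const card_ffun !card_ord scs => /esym/eqP.
have : (0 < d ^ n)%N by rewrite expn_gt0 d0.
case: (d ^ n)%N => // m _; rewrite -subr_eq0 -mulrnBl => /eqP/(lmod_mulrn_eq0 chK)/eqP.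
by rewrite subr_eq0 => /eqP.
Qed.

(** * Trace products and the partition delta_d *)

Lemma geq_total : total geq.
Proof. by move=> x y /=; apply: leq_total. Qed.
Lemma geq_trans : transitive geq.
Proof. by move=> x y z /= h1 h2; apply: leq_trans h2 h1. Qed.
Lemma geq_anti : antisymmetric geq.
Proof. by move=> x y /=; rewrite andbC => /anti_leq. Qed.

Lemma deltaS d : delta d.+1 = (2 * d).+1 :: delta d.
Proof.
rewrite /delta /= subn0; congr cons; first by lia.
by rewrite -[1%N]addn0 iotaDl -map_comp; apply: eq_map => i /=; congr (_ - _)%N; lia.
Qed.

Lemma mem_delta d a : (a \in delta d) = odd a && (a < 2 * d)%N.
Proof.
elim: d => [|d IHd]; first by rewrite muln0 ltn0 andbF.
rewrite deltaS inE IHd; have [->|ne] := eqVneq a (2 * d).+1.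
  by rewrite /= oddM /=; lia.
by case: (boolP (odd a)) => //= oa; move: ne oa; lia.
Qed.

Lemma uniq_delta d : uniq (delta d).
Proof. by elim: d => // d IHd; rewrite deltaS /= IHd mem_delta andbT; lia. Qed.

Lemma sumn_delta d : sumn (delta d) = (d ^ 2)%N.
Proof. by elim: d => // d IHd; rewrite deltaS /= IHd; lia. Qed.

Lemma sorted_delta d : sorted geq (delta d).
Proof.
elim: d => // d IHd; rewrite deltaS /= (path_sortedE geq_trans) IHd andbT.
by apply/allP => x; rewrite mem_delta /= => /andP[_]; lia.
Qed.

(** The elements of [delta d] missing from [l] are positive with sum 0, so there are none. *)
Lemma sort_geq_delta d (l : seq nat) :
  uniq l -> {subset l <= delta d} -> sumn l = (d ^ 2)%N -> sort geq l = delta d.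
Proof.
move=> ul sub_l sum_l.
have pl : perm_eq l [seq a <- delta d | a \in l].
  apply: uniq_perm => //; first by rewrite filter_uniq // uniq_delta.
  by move=> a; rewrite mem_filter andb_idr //; apply: sub_l.
have pf : perm_eq ([seq a <- delta d | a \in l] ++ [seq a <- delta d | a \notin l]) (delta d).
  exact: permEl (perm_filterC (mem l) (delta d)).
have rest0 : [seq a <- delta d | a \notin l] = [::].
  have : sumn [seq a <- delta d | a \notin l] = 0%N.
    have := sumn_delta d; rewrite -sum_l (perm_sumn pl).
    rewrite -(perm_sumn pf) sumn_cat.
    by move/eqP; rewrite -[X in _ == X]addn0 eqn_add2l => /eqP.
  have pos : all (leq 1) [seq a <- delta d | a \notin l].
    by apply/allP => a; rewrite mem_filter mem_delta => /and3P[_]; case: a.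
  by case: [seq _ <- _ | _] pos => // a s /= /andP[]; lia.
apply: (sorted_eq geq_trans geq_anti (sort_sorted geq_total l) (sorted_delta d)).
by rewrite perm_sort; apply: perm_trans pl _; rewrite rest0 cats0 in pf.
Qed.

Lemma intr_eq0_pchar (F : fieldType) (c : int) : [pchar F] =i pred0 -> c%:~R = 0 :> F -> c = 0.
Proof.
move=> /pcharf0P ch0; case: c => n /eqP; first by rewrite -pmulrn ch0 => /eqP ->.
by rewrite NegzE mulrNz oppr_eq0 -pmulrn ch0.
Qed.

(** * Nonvanishing of ST(lambda) in terms of trace products *)

Section Main.
Variables (K : fieldType) (d : nat).
Hypotheses (chK : [pchar K] =i pred0) (d0 : (0 < d)%N).
Let N := #|{: 'I_d * 'I_d}|.
Local Notation X := (generic_mx K d).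

Let card_pairs : N = (d ^ 2)%N.
Proof. by rewrite /N card_prod card_ord mulnn. Qed.

Definition nonvanishing (l : seq nat) : Prop :=
  exists z, unzip1 z = l /\ entry_prod X z != 0.

Definition trace_prod (l : seq nat) : 'M[K]_((jw_dim N).+1) := \prod_(a <- l) \tr (X ^+ a).

Definition cycle_sums (mu : seq nat) (s : 'S_(size mu)) : seq nat :=
  [seq (\sum_(i in c) nth 0%N mu (val i))%N | c : {set 'I_(size mu)} <- enum (porbits s)].

Lemma perm_nonvanishing (l l' : seq nat) : perm_eq l l' -> nonvanishing l -> nonvanishing l'.
Proof.
rewrite perm_sym => /(perm_iotaP 0%N)[Is pIs ->] [z [zl znz]].
have sz : size z = size l by rewrite -zl size_map.
pose z0 : nat * ('I_d * 'I_d) := (0%N, (Ordinal d0, Ordinal d0)).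
exists [seq nth z0 z i | i <- Is]; split.
  rewrite /unzip1 -map_comp; apply/eq_in_map => i; rewrite (perm_mem pIs) mem_iota /= add0n => il.
  by rewrite -zl (nth_map z0) // sz.
have pz : perm_eq z [seq nth z0 z i | i <- Is].
  by rewrite -{1}(mkseq_nth z0 z) sz; apply: perm_map; rewrite perm_sym.
have [b hb] := perm_signed_prod fst pz; move: znz; rewrite /entry_prod hb.
  by apply: contra_neq => ->; rewrite mulr0.
by move=> t u; apply: mxexp_signed_comm; apply: generic_mx_anticomm.
Qed.

Lemma perm_trace_prod (l l' : seq nat) : perm_eq l l' -> trace_prod l != 0 -> trace_prod l' != 0.
Proof.
case/(perm_signed_prod id) => b hb; rewrite /trace_prod hb.
  by apply: contra_neq => ->; rewrite mulr0.
by move=> a c; apply: mxtrace_expr_signed_comm; apply: generic_mx_anticomm.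
Qed.

Lemma trace_prod_delta (l : seq nat) : trace_prod l != 0 -> all (leq 1) l ->
  sumn l = (d ^ 2)%N -> sort geq l = delta d.
Proof.
move=> nz /allP pos; have two (x : 'M[K]_((jw_dim N).+1)) : x + x = 0 -> x = 0.
  exact: (lmod_mulrn_eq0 chK (m := 1)).
have antiX := @generic_mx_anticomm K d.
have nz_a a : a \in l -> \tr (X ^+ a) != 0.
  by move=> al; apply: contra_neq nz; exact: (prod_mem_eq0 (u := fun a => \tr (X ^+ a)) al).
have odd_a a : a \in l -> odd a.
  move=> al; apply: contraNT (nz_a a al) => ea; apply/eqP.
  by apply: (mxtrace_expr_even antiX two) => //; apply: pos.
apply: sort_geq_delta.
  (* Setting even indices to 0 makes anticommutation and vanishing squares hold for every index,
     without changing the product over [l], whose parts are odd. *)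
  pose e a := if odd a then \tr (X ^+ a) else 0.
  have e_anti a b : e a * e b = - (e b * e a).
    rewrite /e; case: (boolP (odd a)) => oa; case: (boolP (odd b)) => ob; rewrite ?mulr0 ?mul0r ?oppr0 //.
    by rewrite (mxtrace_expr_signed_comm antiX) -signr_odd oddM oa ob expr1 mulN1r.
  have e_sqr a : e a * e a = 0.
    by rewrite /e; case: ifP => oa; rewrite ?mulr0 // (mxtrace_expr_odd_sqr antiX two).
  apply: contraNT nz => /(anticomm_prod_nuniq e_anti e_sqr) e0; rewrite /trace_prod -e0.
  by apply/eqP; rewrite [LHS]big_seq [RHS]big_seq; apply: eq_bigr => a /odd_a; rewrite /e => ->.
move=> a al; rewrite mem_delta odd_a //= ltnNge; apply: contraNN (nz_a a al) => le_a.
rewrite -(subnK le_a) exprD (anticommuting_mxexp_eq0 chK antiX d0) mulr0.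
by rewrite mxtrace0.
Qed.

Lemma generic_top z (l : seq nat) (g : 'I_(sumn l) -> 'I_d * 'I_d) :
  unzip1 z = l -> injective g -> (forall q, q \in codom g) ->
  entry_prod X z = alt_coef (fun t => delta_mx (g t).1 (g t).2 : 'M[K]_d) z *:
    \prod_t generic_entry K (g t).
Proof.
move=> zl; case: l / zl g => g g_inj g_full.
have := entry_prod_top (@generic_mxE K d) (@generic_entry_anticomm K d) (r := 1) g_inj.
rewrite !mulr1; apply => h; rewrite mulr1 -big_prod_codom => /prod_generic_nuniq u.
by split=> [|q _]; [apply: uniq_codom_inj | apply: g_full].
Qed.

Section Parts.
Variable mu : seq nat.
Let n := size mu.
Let part (r : 'I_n) := nth 0%N mu (val r).

Lemma generic_tensor_entry_prod (i j : {ffun 'I_n -> 'I_d}) :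
  generic_tensor K part i j = entry_prod X (coord_seq [ffun r => (i r, j r)]).
Proof.
rewrite /entry_prod /coord_seq big_map /generic_tensor [index_enum _]unlock -enumT.
by apply: eq_bigr => r _; rewrite ffunE.
Qed.

(** A nonzero contraction has a nonzero summand, which is a coordinate of the tensor of [mu]. *)
Lemma nonvanishing_cycle_sums (s : 'S_n) : trace_prod (cycle_sums s) != 0 -> nonvanishing mu.
Proof.
have [b hb] := trace_contraction part s chK d0 (@generic_mx_anticomm K d).
rewrite /trace_prod big_map => nz.
have [g gnz|all0] := pickP (fun g : {ffun 'I_n -> 'I_d} =>
    generic_tensor K part g [ffun r => g (s r)] != 0).
  exists (coord_seq [ffun r => (g r, [ffun r => g (s r)] r)]); split; first exact: coord_seq_parts.
  by rewrite -generic_tensor_entry_prod.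
case/eqP: nz; move: hb; rewrite big1 => [|g _].
  by move/esym; rewrite mulr_sign; case: b => // /eqP; rewrite oppr_eq0 => /eqP.
rewrite -[RHS](eqP (negbFE (all0 g))); by apply: eq_bigr => r _; rewrite ffunE.
Qed.

Lemma cycle_sums_nonvanishing : sumn mu = N -> nonvanishing mu ->
  exists s : 'S_n, trace_prod (cycle_sums s) != 0.
Proof.
move=> sum_mu [z [zmu znz]].
have [s snz|all0] := pickP (fun s : 'S_n => trace_prod (cycle_sums s) != 0); first by exists s.
case/eqP: znz; have [f fz] := coord_seq_surj zmu.
pose i : {ffun 'I_n -> 'I_d} := [ffun r => (f r).1].
pose j : {ffun 'I_n -> 'I_d} := [ffun r => (f r).2].
have -> : z = coord_seq [ffun r => (i r, j r)].
  rewrite -fz; by congr coord_seq; apply/ffunP => r; rewrite !ffunE; apply: surjective_pairing.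
rewrite -generic_tensor_entry_prod.
pose g (t : 'I_(sumn mu)) : 'I_d * 'I_d := enum_val (cast_ord sum_mu t).
have g_inj : injective g by move=> t u /enum_val_inj /cast_ord_inj.
pose w := \prod_t generic_entry K (g t).
have pg : perm_eq (codom g) (enum {: 'I_d * 'I_d}).
  apply: uniq_perm; rewrite ?enum_uniq //; first exact/injectiveP.
  move=> q; rewrite mem_enum; apply/codomP; exists (cast_ord (esym sum_mu) (enum_rank q)).
  by rewrite /g cast_ordKV enum_rankK.
have wE : w = \prod_(q <- codom g) generic_entry K q by rewrite big_prod_codom.
have w_nz : w != 0 by rewrite wE prod_generic_neq0.
(* The coefficients are taken in the integers because the sum of squares argument needs an order,
   which K need not have. *)
pose T (i j : {ffun 'I_n -> 'I_d}) : int :=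
  alt_coef (fun t => delta_mx (g t).1 (g t).2 : 'M[int]_d) (coord_seq [ffun r => (i r, j r)]).
have TE k l : generic_tensor K part k l = (T k l)%:~R *: w.
  rewrite generic_tensor_entry_prod; set zz := coord_seq _.
  have zzmu : unzip1 zz = mu by apply: coord_seq_parts.
  rewrite (generic_top zzmu g_inj) => [|q]; last by rewrite (perm_mem pg) mem_enum.
  rewrite /T rmorph_alt_coef; congr (_ *: _); apply: eq_alt_coef => t.
  by rewrite map_delta_mx.
rewrite TE; have -> : T i j = 0; last by rewrite scale0r.
apply: invariant_tensor_eq0 => [a b k l|s].
  apply/eqP; rewrite -subr_eq0 -sumrB; apply/eqP/(intr_eq0_pchar chK)/eqP.
  (* The tensor entries are multiples of [w], which the derivation annihilates; comparing
     coefficients of [w] gives the invariance of [T]. *)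
  have := gl_op_generic_tensor K part a b k l.
  have -> : commutator (gl_op K a b) (generic_tensor K part k l) = 0.
    rewrite TE /commutator -scalerAr -scalerAl -scalerBr -/(commutator _ _) wE.
    by rewrite gl_op_prod ?scaler0.
  move/esym/eqP; rewrite (eq_bigr (fun p => ((k p == a)%:R * T (set_at k p b) l
       - (l p == b)%:R * T k (set_at l p a))%:~R *: w)) => [|p _].
    by rewrite -scaler_suml scaler_eq0 (negbTE w_nz) orbF -rmorph_sum.
  rewrite !TE rmorphB !rmorphM /= !rmorph_nat scalerBl -!scalerA.
  by case: (k p == a); case: (l p == b); rewrite ?mul1r ?mul0r ?scale1r ?scale0r.
apply: (intr_eq0_pchar chK); apply/eqP; rewrite rmorph_sum /=.
have [b hb] := trace_contraction part s chK d0 (@generic_mx_anticomm K d).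
have := all0 s; rewrite /trace_prod big_map => /negbFE/eqP t0; move: hb; rewrite t0 mulr0.
move/eqP; rewrite (eq_bigr (fun g => (T g [ffun r => g (s r)])%:~R *: w)) => [|h _].
  by rewrite -scaler_suml scaler_eq0 (negbTE w_nz) orbF.
by rewrite -TE; apply: eq_bigr => r _; rewrite ffunE.
Qed.

Lemma sumn_cycle_sums (s : 'S_n) : sumn (cycle_sums s) = sumn mu.
Proof.
rewrite /cycle_sums sumnE big_map.
transitivity (\sum_(r <- flatten [seq orbit_cycle s C | C <- enum (porbits s)]) part r)%N.
  rewrite big_flatten big_map big_seq [RHS]big_seq; apply: eq_bigr => C; rewrite mem_enum.
  by case/orbit_cycleP => _ _ u m; rewrite big_uniq //; apply: eq_bigl.
rewrite (perm_big _ (perm_orbit_cycles s)) big_enum /= -(big_mkord xpredT (nth 0%N mu)).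
by rewrite -(big_nth 0%N xpredT id) sumnE.
Qed.

Lemma cycle_sums_pos (s : 'S_n) : all (leq 1) mu -> all (leq 1) (cycle_sums s).
Proof.
move=> /allP pos; apply/allP => _ /mapP[C + ->]; rewrite mem_enum => /imsetP[r _ ->].
rewrite (bigD1 r) ?porbit_id //=; apply: leq_trans (leq_addr _ _).
by apply: pos; apply: mem_nth.
Qed.
End Parts.

Lemma nonvanishing_refines (mu : seq nat) : all (leq 1) mu -> sumn mu = (d ^ 2)%N ->
  nonvanishing mu -> exists s : 'S_(size mu), cycle_part s = delta d.
Proof.
move=> pos sum_mu /cycle_sums_nonvanishing[|s nz]; first by rewrite sum_mu card_pairs.
exists s; apply: trace_prod_delta nz _ _; first exact: cycle_sums_pos.
by rewrite sumn_cycle_sums.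
Qed.

(* The product of all generators is the tensor of the partition (1, ..., 1), whose nonzero
   contraction can only be the one of delta_d. *)
Lemma trace_prod_delta_neq0 : trace_prod (delta d) != 0.
Proof.
pose mu := nseq N 1%N.
have sum_mu : sumn mu = N by rewrite sumn_nseq mul1n.
have nv : nonvanishing mu.
  exists [seq (1%N, q) | q <- enum {: 'I_d * 'I_d}]; split.
    by rewrite /unzip1 -map_comp /mu /N cardE; elim: (enum _) => //= q s ->.
  rewrite /entry_prod big_map; under eq_bigr do rewrite expr1 mxE -surjective_pairing.
  by rewrite prod_generic_neq0.
have [s nz] := cycle_sums_nonvanishing sum_mu nv.
have sE : sort geq (cycle_sums s) = delta d.
  apply: trace_prod_delta nz _ _; last by rewrite sumn_cycle_sums sum_mu card_pairs.
  by apply: cycle_sums_pos; rewrite all_nseq orbT.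
by rewrite -sE; apply: perm_trace_prod nz; rewrite perm_sym perm_sort.
Qed.

Lemma refines_nonvanishing (mu : seq nat) : refines mu (delta d) -> nonvanishing mu.
Proof.
case=> s sE; apply: (@nonvanishing_cycle_sums mu s).
apply: perm_trace_prod trace_prod_delta_neq0; rewrite -sE.
by rewrite perm_sort.
Qed.
End Main.

Theorem mainTheorem4 (F : fieldType) (d k : nat) (lam : seq nat) :
  [pchar F]%R =i pred0 -> (1 <= d)%N ->
  is_partition lam -> sumn lam = k ->
  (~ ST_is_TPI F d lam) <->
  ((k <= d ^ 2)%N /\ refines (pad_ones lam (d ^ 2 - k)) (delta d)).
Proof.
move=> chF d0 /andP[_ pos] sum_lam; set mu := pad_ones _ _.
have card_pairs : #|{: 'I_d * 'I_d}| = (d ^ 2)%N by rewrite card_prod card_ord mulnn.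
have pmu : perm_eq (lam ++ nseq (d ^ 2 - k) 1%N) mu by rewrite perm_sym perm_sort.
split=> [nTPI | [_ ref]].
(* The right-hand side is decidable, permutations being finite in number, so it suffices to refute
   its failure: then every coordinate of ST(lambda) would vanish. *)
- have [/andP[le_k /existsP[s /eqP sE]]|nref] :=
      boolP ((k <= d ^ 2)%N && [exists s : 'S_(size mu), cycle_part s == delta d]).
    by split=> //; exists s.
  case: nTPI => A f; apply/eqP/negPn/negP => /(ST_neq0_pad chF).
  case=> le_k [z [zE znz]]; rewrite card_pairs sum_lam in le_k zE.
  have nv : nonvanishing F d (lam ++ nseq (d ^ 2 - k) 1%N) by exists z.
  case/negP: nref; rewrite le_k /=.
  have [||s sE] := nonvanishing_refines chF d0 (mu := mu) _ _ (perm_nonvanishing d0 pmu nv).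
  + by rewrite -(perm_all _ pmu) all_cat pos all_nseq orbT.
  + by rewrite -(perm_sumn pmu) sumn_cat sumn_nseq mul1n sum_lam subnKC.
  by apply/existsP; exists s; apply/eqP.
- move=> TPI; move: pmu; rewrite perm_sym => pmu.
  have [z [zE znz]] := perm_nonvanishing d0 pmu (refines_nonvanishing chF d0 ref).
  have [A [f /eqP]] := pad_ST_neq0 chF zE znz; apply; exact: TPI.
Qed.
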